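(* Let $(S(t))_{t\ge 0}$ be a strongly continuous, convex semigroup on $C_0$ with generator $A_\infty$ (w.r.t. the supremum norm) such that $$|S(t)f|\le T(t)|f|\quad\text{for all } t\ge 0 \text{ and } f\in C_0\cap M^\Phi,$$ where $(T(t))_{t\ge 0}$ is the family of operators $T(t)\colon M^\Phi_+\to M^\Phi_+$ given by $$\big(T(t)f\big)(x)=\varphi^{-1}\Big(\mathbb{E}\big[\varphi(e^{at}f(x+X_t))\big]\Big).$$ Then the following statements hold: (i) $S(t)\colon C_0\cap M^\Phi\to C_0\cap M^\Phi$ for all $t\ge 0$. (ii) $\|S(t)f\|_{\Phi,R}\le e^{at}\|f\|_{\Phi,R}$ for all $t\ge 0$, $R\ge 1$ and $f\in C_0\cap B_R(e^{-at})$. (iii) $\|S(t)f-S(t)g\|_{\Phi,R}\le 4e^{at}\|f-g\|_{\Phi,R}$ for all $t\ge 0$, $R\ge 1$ and $f,g\in C_0\cap B_R(e^{-at}/3)$. (iv) For every $f\in M^\Phi$ and $t_0\ge 0$, there exist $R\ge 1$ and $r>0$ such that $$\|S(t)g-S(t)h\|_\Phi\le 4Re^{at}\|g-h\|_\Phi\quad\text{for all } t\in[0,t_0] \text{ and } g,h\in C_0\cap B_\Phi(f,r).$$ Hence, for every $t\ge 0$, the operator $S(t)$ (restricted to $C_0\cap M^\Phi$) has a unique continuous extension $\tilde S(t)\colon M^\Phi\to M^\Phi$, and these extensions satisfy properties (ii)–(iv) without the restriction to functions in $C_0$. Furthermore, $(\tilde S(t))_{t\ge 0}$ is a strongly continuous,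 convex semigroup on $M^\Phi$. For all $f\in D(A_\infty)\cap C_c$ with $A_\infty f\in C_c$, it holds $$\lim_{t\downarrow 0}\left\|\frac{S(t)f-f}{t}-A_\infty f\right\|_\Phi=0.$$
   Context: Fix $d\in\mathbb{N}$ and let $\lambda$ be Lebesgue measure on $\mathbb{R}^d$. Write $\mathbb{R}_+=[0,\infty)$. Let $\varphi\colon\mathbb{R}_+\to\mathbb{R}_+$ be convex, strictly increasing and twice continuously differentiable with $\lim_{x\to\infty}\varphi(x)=\infty$, with inverse $\varphi^{-1}\colon[\varphi(0),\infty)\to\mathbb{R}_+$. Put $\Phi\colon\mathbb{R}\to\mathbb{R}_+$, $\Phi(x)=\varphi(|x|)-\varphi(0)$. Fix $a\ge 0$. Orlicz heart: $M^\Phi$ is the set of ($\lambda$-a.e. equivalence classes of) Borel measurable $f\colon\mathbb{R}^d\to\mathbb{R}$ with $\int_{\mathbb{R}^d}\Phi(f/m)\,d\lambda<\infty$ for all $m>0$; it is ordered by $f\le g$ iff $f(x)\le g(x)$ for $\lambda$-a.e. $x$. $M^\Phi_+=\{f\in M^\Phi: f\ge 0\}$. For $R\ge 1$, $\|f\|_{\Phi,R}=\inf\{m>0:\int_{\mathbb{R}^d}\Phi(f/m)\,d\lambda\le R\}$, and $\|f\|_\Phi=\|f\|_{\Phi,1}$ (Luxemburg norm, the norm of $M^\Phi$). Balls: $B_R(f,r)=\{g\in M^\Phi:\|g-f\|_{\Phi,R}\le r\}$, $B_R(r)=B_R(0,r)$, $B_\Phi(f,r)=B_1(f,r)$. Let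 $(X_t)_{t\ge 0}$ be a $d$-dimensional Lévy process on a probability space $(\Omega,\mathcal{F},\mathbb{P})$ (stationary and independent increments, values in $\mathbb{R}^d$, $X_0=0$ a.s.), with expectation $\mathbb{E}$. Standing assumption: (a) for all $t>0$, the distribution $\mathbb{P}\circ X_t^{-1}$ is absolutely continuous w.r.t. $\lambda$ with essentially bounded Radon–Nikodym derivative; (b) for every $c\ge 0$ there exists $r\ge 0$ such that $\lim_{t\downarrow 0}\mathbb{P}(|X_t|\ge r)\,\Phi(c/t)=0$. $C_0$ is the space of continuous $f\colon\mathbb{R}^d\to\mathbb{R}$ vanishing at infinity, with the supremum norm $\|\cdot\|_\infty$; $C_c$ is the set of continuous functions $\mathbb{R}^d\to\mathbb{R}$ with compact support. For $E=C_0$ or $E=M^\Phi$, a strongly continuous, convex semigroup on $E$ is a family of (not necessarily linear) operators $S(t)\colon E\to E$, $t\ge 0$, with $S(0)=\mathrm{id}_E$, $S(s+t)=S(s)S(t)$ for all $s,t\ge0$, $\lim_{t\downarrow 0}S(t)f=f$ in the norm of $E$ for all $f\in E$, and each $S(t)$ convex: $S(t)(\mu f+(1-\mu)g)\le\mu S(t)f+(1-\mu)S(t)g$ for all $f,g\in E$, $\mu\in[0,1]$. The generator $A_\infty\colon D(A_\infty)\to C_0$ of the semigroup on $C_0$ is $A_\infty f=\lim_{t\downarrow 0}\frac{S(t)f-f}{t}$, limit in $\|\cdot\|_\infty$, with $D(A_\infty)$ the set of all $f\in C_0$ for which this limit exists. *)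

(* Defs.v *)
From HB Require Import structures.
From mathcomp Require Import all_boot all_order all_algebra.
From mathcomp Require Import all_classical all_reals all_analysis measurable_realfun.
Set Implicit Arguments. Unset Strict Implicit. Unset Printing Implicit Defensive.
Import Order.TTheory GRing.Theory Num.Theory.
Import numFieldNormedType.Exports.
Local Open Scope classical_set_scope.
Local Open Scope ring_scope.

(* The Borel sigma-algebra, generated by the open sets, on matrices. *)
Definition mx_borel_display : measure_display. Proof. by constructor. Qed.

Section mx_borel.
Context (R : realType) (m n : nat).
Definition mx_borel : set (set 'M[R]_(m, n)) := <<s @open 'M[R]_(m, n) >>.
Let mx_borel0 : mx_borel set0. Proof. exact: sigma_algebra0. Qed.
Let mx_borelC A : mx_borel A -> mx_borel (~` A).
Proof. exact: sigma_algebraC. Qed.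
Let mx_borel_bigcup (F : (set 'M[R]_(m, n))^nat) :
  (forall i, mx_borel (F i)) -> mx_borel (\bigcup_i (F i)).
Proof. exact: sigma_algebra_bigcup. Qed.
HB.instance Definition _ := @isMeasurable.Build mx_borel_display
  'M[R]_(m, n) mx_borel mx_borel0 mx_borelC mx_borel_bigcup.
End mx_borel.

Section cons_rv.
Context (R : realType) (n : nat).

Definition cons_rv (p : R * 'rV[R]_n) : 'rV[R]_n.+1 :=
  row_mx (p.1%:M : 'rV[R]_1) p.2.

Lemma open_mx_measurable (m k : nat) (U : set 'M[R]_(m, k)) : open U -> measurable U.
Proof. by move=> oU; apply: sub_sigma_algebra. Qed.

Let rball (p : 'rV[rat]_n.+1 * nat) : set 'rV[R]_n.+1 :=
  ball (map_mx (@ratr R) p.1) p.2.+1%:R^-1.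

Let open_rball (U : set 'rV[R]_n.+1) : open U ->
  U = \bigcup_(p in [set p | rball p `<=` U]) rball p.
Proof.
move=> oU; apply/seteqP; split=> [x Ux|x [p pU /pU//]].
have /nbhs_ballP[e /= e0 eU] : nbhs x U by exact: open_nbhs_nbhs.
have [k ke] : exists k : nat, k.+1%:R^-1 < e / 2.
  have e20 : 0 < e / 2 by rewrite divr_gt0.
  exists (Num.truncn (e / 2)^-1).
  rewrite invf_plt ?posrE ?ltr0Sn//.
  by rewrite truncnS_gt.
have q_ i : exists q : rat, `|x ord0 i - ratr q| < k.+1%:R^-1.
  have k0 : 0 < k.+1%:R^-1 :> R by rewrite invr_gt0.
  have [||y [xy [q _ qy]] ] := @dense_rat R (ball (x ord0 i) k.+1%:R^-1).
  - by exists (x ord0 i); exact: ballxx.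
  - exact: ball_open.
  by exists q; rewrite qy.
have [q qP] := choice q_.
exists (\row_i q i, k); rewrite /rball/=.
- move=> y /= yq; apply: eU.
  rewrite [e]splitr.
  apply: (@le_ball _ _ _ (k.+1%:R^-1 + k.+1%:R^-1)).
    by apply: lerD; exact: ltW.
  apply: ball_triangle yq; split=> [|i j]; first by rewrite invr_gt0.
  by rewrite !mxE ord1; exact: qP.
- split=> [|i j]; first by rewrite invr_gt0.
  by rewrite !mxE ord1 /ball /= distrC; exact: qP.
Qed.

Lemma measurable_cons_rv : measurable_fun setT cons_rv.
Proof.
apply: (@measurability _ _ _ _ _ _ (@open 'rV[R]_n.+1)) => //.
move=> _ [U oU <-]; rewrite setTI.
rewrite (open_rball oU) preimage_bigcup.
rewrite bigcup_mkcond; apply: countable_bigcupT_measurable => // -[q k].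
case: ifPn => // _.
rewrite (_ : _ @^-1` _ = ball (ratr (q ord0 ord0) : R) k.+1%:R^-1 `*`
   ball (\row_j (ratr (q ord0 (lift ord0 j)) : R)) k.+1%:R^-1); last first.
  apply/seteqP; split=> -[x v]; rewrite /rball/cons_rv /=.
  - move=> -[k0 qv]; split=> /=.
      by have := qv ord0 ord0; rewrite !mxE split1 unlift_none /= !mxE eqxx.
    split=> [|i j]; first exact: k0.
    have := qv ord0 (lift ord0 j).
    by rewrite (ord1 i) !mxE split1 liftK.
  - move=> [qx [k0 qv]]; split=> [|i j]; first exact: k0.
    rewrite !mxE split1 ord1; case: unliftP => [j' ->|->] /=.
      by have := qv ord0 j'; rewrite !mxE.
    by rewrite !mxE eqxx.
apply: measurableX; first exact: measurable_ball.
apply: open_mx_measurable; apply: ball_open; by rewrite invr_gt0.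
Qed.

Variable mu : {sigma_finite_measure set 'rV[R]_n -> \bar R}.

Definition cons_measure : set 'rV[R]_n.+1 -> \bar R :=
  pushforward (@lebesgue_measure R \x mu)%E cons_rv.


Let cons_measure0 : cons_measure set0 = 0%E.
Proof. by rewrite /cons_measure /pushforward preimage_set0 measure0. Qed.

Let cons_measure_ge0 A : (0 <= cons_measure A)%E.
Proof. by rewrite /cons_measure /pushforward; exact: measure_ge0. Qed.

Let cons_measure_sigma_additive : semi_sigma_additive cons_measure.
Proof.
by have mc := measurable_cons_rv; exact: measure_semi_sigma_additive.
Qed.

HB.instance Definition _ := isMeasure.Build _ _ _ cons_measure
  cons_measure0 cons_measure_ge0 cons_measure_sigma_additive.

Definition behead_rv (w : 'rV[R]_n.+1) : 'rV[R]_n := \row_j w ord0 (lift ord0 j).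

Lemma head_cons_rv x (v : 'rV[R]_n) : cons_rv (x, v) ord0 ord0 = x.
Proof. by rewrite /cons_rv mxE split1 unlift_none /= !mxE eqxx. Qed.

Lemma behead_cons_rv x (v : 'rV[R]_n) : behead_rv (cons_rv (x, v)) = v.
Proof. by apply/rowP => j; rewrite /cons_rv !mxE split1 liftK. Qed.

Let measurable_behead_rv : measurable_fun setT behead_rv.
Proof.
apply: (@measurability _ _ _ _ _ _ (@open 'rV[R]_n)) => //.
move=> _ [U oU <-]; rewrite setTI; apply: open_mx_measurable.
apply: open_comp => // w _ A /nbhs_ballP[e /= e0 eA].
apply/nbhs_ballP; exists e => //= v [_ wv]; apply: eA; split=> // i j.
by rewrite !mxE; exact: wv.
Qed.

Let measurable_head_rv : measurable_fun setT (fun w : 'rV[R]_n.+1 => w ord0 ord0).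
Proof.
apply: (measurability _ (RGenOpens.measurableE R)) => //.
move=> _ [_ [x [y ->]] <-]; rewrite setTI; apply: open_mx_measurable.
apply: open_comp; last exact: interval_open.
by move=> w _; exact: coord_continuous.
Qed.

Let cons_measure_sigma_finite : sigma_finite setT cons_measure.
Proof.
have /sigma_finiteP[F [TF ndF Foo]] := sigma_finiteT (@lebesgue_measure R).
have /sigma_finiteP[G [TG ndG Goo]] := sigma_finiteT mu.
exists (fun k => [set w : 'rV[R]_n.+1 | F k (w ord0 ord0) /\ G k (behead_rv w)]).
  apply/esym/seteqP; split=> // w _.
  have [i _ Fi] : (\bigcup_i F i) (w ord0 ord0) by rewrite -TF.
  have [k _ Gk] : (\bigcup_i G i) (behead_rv w) by rewrite -TG.
  exists (maxn i k) => //; split.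
  - by move: Fi; exact/subsetPset/ndF/leq_maxl.
  - by move: Gk; exact/subsetPset/ndG/leq_maxr.
move=> k; have [mF Fk] := Foo k; have [mG Gk] := Goo k; split.
  apply: measurableI.
    by rewrite -[X in measurable X]setTI; exact: measurable_head_rv.
  by rewrite -[X in measurable X]setTI; exact: measurable_behead_rv.
rewrite /cons_measure /pushforward.
rewrite (_ : _ @^-1` _ = F k `*` G k).
  by rewrite product_measure1E// lte_mul_pinfty// ge0_fin_numE.
by apply/seteqP; split=> -[x v] /=; rewrite behead_cons_rv head_cons_rv.
Qed.

HB.instance Definition _ := Measure_isSigmaFinite.Build _ _ _ cons_measure
  cons_measure_sigma_finite.

End cons_rv.

(* Lebesgue measure on R^n as an iterated product: lambda_0 is the Dirac mass on
   the one-point space and lambda_(n+1) is the image of lambda_1 \x lambda_n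
   under the identification R * R^n = R^(n+1); see lebesgue_rV_box. *)
Fixpoint lebesgue_rV (R : realType) (n : nat) :
    {sigma_finite_measure set 'rV[R]_n -> \bar R} :=
  match n with
  | 0 => \d_(0 : 'rV[R]_0)
  | k.+1 => cons_measure (lebesgue_rV R k)
  end.

Lemma measurable_box_rV (R : realType) (n : nat) (a b : 'rV[R]_n) :
  measurable [set x : 'rV[R]_n | forall i, a ord0 i <= x ord0 i <= b ord0 i].
Proof.
rewrite (_ : [set x | _] = \bigcap_(i in setT)
    ((fun x : 'rV[R]_n => x ord0 i) @^-1` `[a ord0 i, b ord0 i])).
  rewrite -[X in measurable X]setCK; apply: measurableC.
  apply: open_mx_measurable; rewrite setC_bigcap.
  apply: bigcup_open => i _; apply: closed_openC; apply: preimage_closed; last exact: interval_closed.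
  by move=> w _; exact: coord_continuous.
apply/seteqP; split=> x /= xab i => [_|]; first by rewrite /= in_itv; exact: xab.
by have := xab i I; rewrite /= in_itv.
Qed.

Lemma lebesgue_rV_box (R : realType) (n : nat) (a b : 'rV[R]_n) :
  (forall i, a ord0 i <= b ord0 i) ->
  lebesgue_rV R n [set x | forall i, a ord0 i <= x ord0 i <= b ord0 i] =
  (\prod_(i < n) (b ord0 i - a ord0 i))%:E.
Proof.
elim: n a b => [|n IHn] a b ab.
  by rewrite big_ord0 /= diracE mem_set//= => -[].
rewrite big_ord_recl EFinM.
have -> : (b ord0 ord0 - a ord0 ord0)%:E =
    lebesgue_measure `[a ord0 ord0, b ord0 ord0].
  rewrite lebesgue_measure_itv /= lte_fin; have := ab ord0.
  by rewrite le_eqVlt => /predU1P[->|->//]; rewrite ltxx subrr.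
have -> : \prod_(i < n) (b ord0 (lift ord0 i) - a ord0 (lift ord0 i)) =
    \prod_(i < n) (behead_rv b ord0 i - behead_rv a ord0 i).
  by apply: eq_bigr => i _; rewrite !mxE.
rewrite -IHn => [|i]; last by rewrite !mxE.
rewrite -product_measure1E//; last exact: measurable_box_rV.
rewrite /= /cons_measure /pushforward; congr (_ _).
have vE x (v : 'rV[R]_n) j : v ord0 j = cons_rv (x, v) ord0 (lift ord0 j).
  by rewrite -{1}(behead_cons_rv x v) mxE.
apply/seteqP; split=> -[x v] /=; rewrite ?in_itv /=.
  move=> xv; split=> [|i]; first by have := xv ord0; rewrite head_cons_rv.
  by have := xv (lift ord0 i); rewrite (vE x v) ![behead_rv _ _ _]mxE.
move=> [xab vab] i; have [j ->|->] := unliftP ord0 i; last by rewrite head_cons_rv.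
by have := vab j; rewrite (vE x v) ![behead_rv _ _ _]mxE.
Qed.

Section analysis_notions.
Context {R : realType} {d : nat}.
Implicit Types (f g : 'rV[R]_d -> R).

(* The library's norm on 'rV[R]_d is the maximum norm. *)
Definition enorm (x : 'rV[R]_d) : R := Num.sqrt (\sum_(i < d) x ord0 i ^+ 2).

Definition C0_fun : set ('rV[R]_d -> R) :=
  [set f | continuous f /\
    forall e : R, 0 < e -> exists r : R, forall x, r <= enorm x -> `|f x| < e].

Definition Cc_fun : set ('rV[R]_d -> R) :=
  [set f | continuous f /\ compact (closure [set x | f x != 0])].

Definition sup_norm f : R := sup (range (fun x => `|f x|)).

Definition ae_equal f g : Prop := {ae lebesgue_rV R d, forall x, f x = g x}.

Definition ae_le f g : Prop := {ae lebesgue_rV R d, forall x, f x <= g x}.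

Definition pointwise_le f g : Prop := forall x, f x <= g x.

(* E is a space of functions taken up to the equivalence eqE, with order leE and
   norm nE; values of S outside E and for t < 0 are irrelevant. *)
Record sc_convex_semigroup (E : set ('rV[R]_d -> R))
    (eqE leE : ('rV[R]_d -> R) -> ('rV[R]_d -> R) -> Prop)
    (nE : ('rV[R]_d -> R) -> R)
    (S : R -> ('rV[R]_d -> R) -> ('rV[R]_d -> R)) : Prop := {
  semigroup_stable : forall (t : R) f, 0 <= t -> E f -> E (S t f) ;
  semigroup_compat : forall (t : R) f g, 0 <= t -> E f -> E g ->
    eqE f g -> eqE (S t f) (S t g) ;
  semigroup_id : forall f, E f -> eqE (S 0 f) f ;
  semigroup_comp : forall (s t : R) f, 0 <= s -> 0 <= t -> E f ->
    eqE (S (s + t) f) (S s (S t f)) ;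
  semigroup_cvg : forall f, E f -> nE (S t f \- f) @[t --> 0^'+] --> 0 ;
  semigroup_convex : forall (t mu : R) f g, 0 <= t -> E f -> E g ->
    0 <= mu <= 1 ->
    leE (S t (fun x => mu * f x + (1 - mu) * g x))
        (fun x => mu * S t f x + (1 - mu) * S t g x) }.

Definition C0_semigroup (S : R -> ('rV[R]_d -> R) -> ('rV[R]_d -> R)) : Prop :=
  sc_convex_semigroup C0_fun eq pointwise_le sup_norm S.

Definition generator_limit (S : R -> ('rV[R]_d -> R) -> ('rV[R]_d -> R)) f g :
    Prop :=
  C0_fun g /\
  sup_norm (fun x => (S t f x - f x) / t - g x) @[t --> 0^'+] --> 0.

Definition generator_domain (S : R -> ('rV[R]_d -> R) -> ('rV[R]_d -> R)) :
    set ('rV[R]_d -> R) :=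
  [set f | C0_fun f /\ exists g, generator_limit S f g].

Definition generator (S : R -> ('rV[R]_d -> R) -> ('rV[R]_d -> R)) f :
    'rV[R]_d -> R :=
  get (generator_limit S f).

End analysis_notions.

Section orlicz.
Context {R : realType} {d : nat}.
Variable phi : R -> R.
Implicit Types (f g : 'rV[R]_d -> R) (rho r m : R).

(* One-sided at the endpoint 0 of the half-line. *)
Definition halfline_derivative (u : R -> R) (x l : R) : Prop :=
  (u y - u x) / (y - x) @[y --> within `[0, +oo[ (dnbhs x)] --> l.

Definition halfline_C2 : Prop := exists phi1 phi2 : R -> R,
  [/\ forall x, 0 <= x -> halfline_derivative phi x (phi1 x),
      forall x, 0 <= x -> halfline_derivative phi1 x (phi2 x) &
      {within `[0, +oo[, continuous phi2}].

Record young_generator : Prop := {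
  young_ge0 : forall x, 0 <= x -> 0 <= phi x ;
  young_convex : convex_function (`[0, +oo[%classic : set R^o) phi ;
  young_increasing : {in `[0, +oo[ &, {homo phi : x y / x < y}} ;
  young_C2 : halfline_C2 ;
  young_cvg : phi x @[x --> +oo] --> +oo }.

Definition young (x : R) : R := phi `|x| - phi 0.

(* The inverse of phi as a map from [phi 0, +oo[ to [0, +oo[. *)
Definition phi_inv : R -> R := 'pinv_(fun=> 0) `[0, +oo[ phi.

Definition modular f m : \bar R :=
  (\int[lebesgue_rV R d]_x (young (f x / m))%:E)%E.

(* Representatives of the elements of the Orlicz heart. *)
Definition orlicz_heart : set ('rV[R]_d -> R) :=
  [set f | measurable_fun setT f /\
    forall m, 0 < m -> (modular f m < +oo)%E].

Definition luxemburg rho f : R :=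
  inf [set m | 0 < m /\ (modular f m <= rho%:E)%E].

Definition orlicz_ball rho f r : set ('rV[R]_d -> R) :=
  [set g | orlicz_heart g /\ luxemburg rho (g \- f) <= r].

Definition orlicz_semigroup (S : R -> ('rV[R]_d -> R) -> ('rV[R]_d -> R)) :
    Prop :=
  sc_convex_semigroup orlicz_heart ae_equal ae_le (luxemburg 1) S.

Definition orlicz_continuous (U : ('rV[R]_d -> R) -> ('rV[R]_d -> R)) : Prop :=
  forall f, orlicz_heart f -> forall e : R, 0 < e -> exists2 delta : R, 0 < delta &
    forall g, orlicz_heart g -> luxemburg 1 (g \- f) < delta ->
      luxemburg 1 (U g \- U f) < e.

(* U is a continuous map on the Orlicz heart (as a space of classes) which
   extends the restriction of U0 to C_0 intersected with the Orlicz heart. *)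
Record continuous_extension (U0 U : ('rV[R]_d -> R) -> ('rV[R]_d -> R)) :
    Prop := {
  extension_stable : forall f, orlicz_heart f -> orlicz_heart (U f) ;
  extension_compat : forall f g, orlicz_heart f -> orlicz_heart g ->
    ae_equal f g -> ae_equal (U f) (U g) ;
  extension_continuous : orlicz_continuous U ;
  extension_eq : forall f, C0_fun f -> orlicz_heart f ->
    ae_equal (U f) (U0 f) }.

Section estimates.
Variables (a : R) (E : set ('rV[R]_d -> R)).
Variable S : R -> ('rV[R]_d -> R) -> ('rV[R]_d -> R).

Definition norm_estimate : Prop := forall (t : R) rho f, 0 <= t -> 1 <= rho ->
  (E `&` orlicz_ball rho (cst 0) (expR (- (a * t)))) f ->
  luxemburg rho (S t f) <= expR (a * t) * luxemburg rho f.

Definition lipschitz_estimate : Prop := forall (t : R) rho f g, 0 <= t -> 1 <= rho ->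
  (E `&` orlicz_ball rho (cst 0) (expR (- (a * t)) / 3)) f ->
  (E `&` orlicz_ball rho (cst 0) (expR (- (a * t)) / 3)) g ->
  luxemburg rho (S t f \- S t g) <= 4 * expR (a * t) * luxemburg rho (f \- g).

Definition local_lipschitz_estimate : Prop := forall f (t0 : R),
  orlicz_heart f -> 0 <= t0 ->
  exists rho r, [/\ 1 <= rho, 0 < r &
    forall (t : R) g h, 0 <= t <= t0 ->
      (E `&` orlicz_ball 1 f r) g -> (E `&` orlicz_ball 1 f r) h ->
      luxemburg 1 (S t g \- S t h)
        <= 4 * rho * expR (a * t) * luxemburg 1 (g \- h)].

End estimates.
End orlicz.

Section levy.
Context {R : realType} {d : nat} {disp : measure_display}
  {Omega : measurableType disp}.
Variables (P : probability Omega R) (X : R -> Omega -> 'rV[R]_d).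

Record levy_process : Prop := {
  levy_measurable : forall t : R, 0 <= t -> measurable_fun setT (X t) ;
  levy_start : {ae P, forall w, X 0 w = 0} ;
  levy_stationary : forall (s t : R) (A : set 'rV[R]_d), 0 <= s -> 0 <= t ->
    measurable A ->
    P [set w | A (X (s + t) w - X s w)] = P [set w | A (X t w)] ;
  levy_independent : forall (n : nat) (t : nat -> R)
    (A : nat -> set 'rV[R]_d), 0 <= t 0%N -> (forall i, t i <= t i.+1) ->
    (forall i, measurable (A i)) ->
    P [set w | forall i, (i < n)%N -> A i (X (t i.+1) w - X (t i) w)] =
    (\prod_(i < n) P [set w | A i (X (t i.+1) w - X (t i) w)%R])%E }.

Definition bounded_densities : Prop := forall t : R, 0 < t ->
  pushforward P (X t) `<< lebesgue_rV R d /\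
  exists g : 'rV[R]_d -> R,
    [/\ measurable_fun setT g, forall x, 0 <= g x,
        forall A, measurable A -> pushforward P (X t) A =
          (\int[lebesgue_rV R d]_(x in A) (g x)%:E)%E &
        exists C : R, {ae lebesgue_rV R d, forall x, g x <= C}].

Definition small_time_tails (phi : R -> R) : Prop := forall c : R, 0 <= c ->
  exists2 r : R, 0 <= r &
    (P [set w | (r <= enorm (X t w))%R] * (young phi (c / t))%:E)%E
      @[t --> 0^'+] --> 0%E.

Definition levy_majorant (phi : R -> R) (a t : R) (f : 'rV[R]_d -> R) :
    'rV[R]_d -> R :=
  fun x => phi_inv phi
    (fine 'E_P[fun w => phi (expR (a * t) * f (x + X t w))]).

End levy.

(* Main.v *)
Require Import Defs.
From HB Require Import structures.
From mathcomp Require Import all_boot all_order all_algebra.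
From mathcomp Require Import all_classical all_reals all_analysis.
From mathcomp Require Import measurable_realfun lra ring.
Set Implicit Arguments. Unset Strict Implicit. Unset Printing Implicit Defensive.
Import Order.TTheory GRing.Theory Num.Theory.
Import numFieldNormedType.Exports.
Local Open Scope classical_set_scope.
Local Open Scope ring_scope.

(** Write [Phi] for [young phi], [M f m] for the modular, that is the integral of
[Phi (f / m)], and [|f|_rho] for the Luxemburg norm at level [rho]; for [m > 0],
[|f|_rho <= m] means [M f m <= rho] ([luxemburg_leP]).

Everything rests on one inequality between modulars. The majorant of [0] vanishes,
so [S t 0 = 0], and convexity lets [S t] grow at least linearly along rays: for
[m <= 1], [|S t f| / m] is at most the larger of [|S t (f / m)|] and
[|S t (- f / m)|]. The majorant applied to [f / m] bounds
[Phi (S t f (x) / m)] by the expectation of [Phi (e^{at} f (x + X_t) / m)]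
([young_semigroup_le]). Integrating over [x], Tonelli and the translation
invariance of Lebesgue measure remove [X_t] ([integral_shift_rv]) and leave
[M (S t f) m <= M f (m e^{-at})] for all [m <= 1] ([modular_semigroup_le]).
This gives (i) and (ii).

Statements (iii) and (iv) follow from (ii) by convexity alone
([convex_difference_bound]): [f] is the convex combination [s p + (1 - s) g]
with [p = g + (f - g) / s], hence [S t f - S t g <= s (S t p - S t g)], and (ii)
bounds [S t p] as long as [p] stays in the ball of radius [e^{-at}], which allows
[s] to be proportional to [|f - g|_rho]. For (iv), a large [rho] makes the norm of
a given [f] so small that this argument applies near [f], and [|.|_1] and [|.|_rho]
are equivalent.

By (iv) each [S t] is locally Lipschitz for [|.|_1], so it extends once [C_0] is
known to be dense ([C00_dense]) and the Orlicz heart to be complete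
([heart_complete]). The extension inherits convexity and (ii) by approximation,
hence also (iii) and (iv) by the same convexity argument. The semigroup law passes
to the limit.

Strong continuity needs to be checked on a dense set only, and both it and the
statement about the generator are proved for continuous [f] with bounded support.
On a large ball uniform convergence suffices. Outside the ball, the same
pointwise inequality only sees the event that [X_t] has moved far
([modular_semigroup_tail]), and the small-time assumption on the tails of [X_t]
is exactly what makes its contribution vanish, even after division by [t]
([semigroup_tail_cvg]). *)

(** * The Young function *)

Section young_function.
Context {R : realType} {phi : R -> R} (hphi : young_generator phi).
Implicit Types x y t : R.
Local Notation Phi := (young phi).

Lemma phi_convex t x y : 0 <= t <= 1 -> 0 <= x -> 0 <= y ->
  phi (t * x + (1 - t) * y) <= t * phi x + (1 - t) * phi y.
Proof.
move=> /andP[t0 t1] x0 y0.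
have /(_ x y) := young_convex hphi (Itv01 t0 t1).
by apply; rewrite inE/= in_itv/= andbT.
Qed.

Lemma phi_homo x y : 0 <= x -> x <= y -> phi x <= phi y.
Proof.
move=> x0; rewrite le_eqVlt => /predU1P[->//|xy]; apply/ltW.
by apply: (young_increasing hphi) => //; rewrite in_itv/= andbT ?(le_trans x0)// ltW.
Qed.

Lemma young0 : Phi 0 = 0. Proof. by rewrite /young normr0 subrr. Qed.

Lemma young_norm x : Phi `|x| = Phi x. Proof. by rewrite /young normr_id. Qed.

Lemma le_young x y : `|x| <= `|y| -> Phi x <= Phi y.
Proof. by move=> xy; rewrite lerD2r phi_homo. Qed.

Lemma young_nonneg x : 0 <= Phi x.
Proof. by rewrite -young0 le_young// normr0. Qed.

Lemma young_gt0 x : x != 0 -> 0 < Phi x.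
Proof.
move=> x0; rewrite subr_gt0; apply: (young_increasing hphi).
- by rewrite in_itv/= lexx.
- by rewrite in_itv/= normr_ge0.
- by rewrite normr_gt0.
Qed.

Lemma young_conv t x y : 0 <= t <= 1 ->
  Phi (t * x + (1 - t) * y) <= t * Phi x + (1 - t) * Phi y.
Proof.
move=> t01; have /andP[t0 t1] := t01.
have := phi_convex t01 (normr_ge0 x) (normr_ge0 y).
have : phi `|t * x + (1 - t) * y| <= phi (t * `|x| + (1 - t) * `|y|).
  apply: phi_homo => //; apply: le_trans (ler_normD _ _) _.
  by rewrite !normrM (ger0_norm t0) (@ger0_norm _ (1 - t)) ?subr_ge0.
rewrite /young; lra.
Qed.

Lemma young_scale t x : 0 <= t <= 1 -> Phi (t * x) <= t * Phi x.
Proof.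
by move=> /(@young_conv t x 0); rewrite mulr0 addr0 young0 mulr0 addr0.
Qed.

Lemma measurable_young : measurable_fun setT Phi.
Proof.
have -> : Phi = (fun y => phi (Num.max 0 y) - phi 0) \o (fun x => `|x|).
  by apply/funext => x /=; rewrite /young; congr (phi _ - _); apply/esym/max_idPr.
apply: measurableT_comp; last exact: measurableT_comp.
apply: nondecreasing_measurable => // x y xy /=; rewrite lerD2r phi_homo//.
  by rewrite le_max lexx.
by rewrite ge_max le_max lexx/= le_max xy orbT.
Qed.

Lemma young_coercive (c : R) : exists2 M, 0 <= M & forall x, Phi x <= c -> `|x| <= M.
Proof.
have /cvgryPgt /(_ (c + phi 0)) [M [_ HM]] := young_cvg hphi.
exists `|M| => // x xc; rewrite leNgt; apply/negP => Mx.
suff : c < Phi x by rewrite ltNge xc.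
by rewrite ltrBrDr; apply: HM; rewrite (le_lt_trans (ler_norm _) Mx).
Qed.

(** [phi_inv] inverts [phi] on its range; off the range it takes the default value
[0], and then [x = 0]. *)
Lemma young_phi_inv x y : 0 <= x -> phi 0 <= y -> x <= phi_inv phi y ->
  phi x <= y.
Proof.
move=> x0 y0; rewrite /phi_inv.
have [yphi|yphi] := boolP (y \in phi @` `[0%R, +oo[%classic).
  by move=> xy; rewrite -[leRHS](pinvK (fun=> 0) yphi) phi_homo.
suff -> : 'pinv_(fun=> 0) `[0%R, +oo[ phi y = 0.
  by move=> x00; rewrite (_ : x = 0)//; apply/eqP; rewrite eq_le x00.
rewrite /pinv_ splitV oinv_surj; case: pselect => //= yphi'.
by case/negP: yphi; rewrite inE; move: yphi' => [z z0 <-]; exists z.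
Qed.
End young_function.

(** * The modular and the Orlicz heart *)

Section modular.
Context {R : realType} {d : nat} {phi : R -> R} (hphi : young_generator phi).
Implicit Types (f g h : 'rV[R]_d -> R) (m p q t rho c : R).
Local Notation mu := (lebesgue_rV R d).
Local Notation M := (@modular R d phi).
Local Notation H := (@orlicz_heart R d phi).
Local Notation lux := (@luxemburg R d phi).

Lemma measurable_modular_integrand f m : measurable_fun setT f ->
  measurable_fun setT (fun x => (young phi (f x / m))%:E).
Proof.
move=> mf; apply/measurable_EFinP; apply: measurableT_comp (measurable_young hphi) _.
exact: measurable_funM.
Qed.

Lemma modular_ge0 f m : (0 <= M f m)%E.
Proof. by apply: integral_ge0 => x _; rewrite lee_fin young_nonneg. Qed.

(** Convexity of [young phi], integrated. The scales [m], [p] and [q] are independent,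
so that monotonicity, homogeneity and the triangle inequality of the Luxemburg
norm are all instances. *)
Lemma modular_conv t f g h m p q : 0 <= t <= 1 ->
  measurable_fun setT f -> measurable_fun setT g -> measurable_fun setT h ->
  {ae mu, forall x, `|h x / m| <= t * `|f x / p| + (1 - t) * `|g x / q|} ->
  (M h m <= t%:E * M f p + (1 - t)%:E * M g q)%E.
Proof.
move=> t01 mf mg mh hfg; have /andP[t0 t1] := t01.
have t1' : 0 <= 1 - t by rewrite subr_ge0.
have [mF mG] := (measurable_modular_integrand p mf, measurable_modular_integrand q mg).
rewrite /modular -!ge0_integralZl//; last 2 first.
- by move=> x _; rewrite lee_fin young_nonneg.
- by move=> x _; rewrite lee_fin young_nonneg.
rewrite -ge0_integralD//; first last.
- exact: measurable_funeM.
- by move=> x _; rewrite mule_ge0// lee_fin// young_nonneg.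
- exact: measurable_funeM.
- by move=> x _; rewrite mule_ge0// lee_fin// young_nonneg.
apply: ae_ge0_le_integral => //.
- by move=> x _; rewrite lee_fin young_nonneg.
- exact: measurable_modular_integrand.
- by move=> x _; rewrite adde_ge0// mule_ge0// lee_fin// young_nonneg.
- by apply: emeasurable_funD; exact: measurable_funeM.
apply: filterS hfg => x hx _; rewrite -!EFinM -EFinD lee_fin.
have := young_conv hphi `|f x / p| `|g x / q| t01; rewrite !young_norm.
apply: le_trans; apply: le_young => //.
by apply: le_trans hx _; exact: ler_norm.
Qed.

Lemma modular_cst0 m : M (cst 0) m = 0%E.
Proof.
by rewrite /modular; under eq_integral do rewrite mul0r young0; rewrite integral0.
Qed.

Lemma modular_scale t f h m p : 0 <= t <= 1 ->
  measurable_fun setT f -> measurable_fun setT h ->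
  {ae mu, forall x, `|h x / m| <= t * `|f x / p|} ->
  (M h m <= t%:E * M f p)%E.
Proof.
move=> t01 mf mh hf.
have := @modular_conv t f (cst 0) h m p 1 t01 mf (measurable_cst _) mh.
rewrite modular_cst0 mule0 adde0; apply.
by apply: filterS hf => x; rewrite mul0r normr0 mulr0 addr0.
Qed.

Lemma le_modular f h m p :
  measurable_fun setT f -> measurable_fun setT h ->
  {ae mu, forall x, `|h x / m| <= `|f x / p|} -> (M h m <= M f p)%E.
Proof.
move=> mf mh hf; rewrite -[leRHS]mul1e; apply: modular_scale => //.
  by rewrite ler01 lexx.
by apply: filterS hf => x; rewrite mul1r.
Qed.

Lemma modular_ltoo f : measurable_fun setT f ->
  (forall e : R, 0 < e -> exists2 m, 0 < m <= e & (M f m < +oo)%E) -> H f.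
Proof.
move=> mf fM; split=> // e /fM[m /andP[m0 me]]; apply: le_lt_trans.
apply: le_modular => //; apply: aeW => x; rewrite !normrM ler_wpM2l// !normfV.
have e0 := lt_le_trans m0 me.
by rewrite lef_pV2 ?posrE ?normr_gt0 ?gt_eqF// !gtr0_norm.
Qed.

Lemma heart_measurable f : H f -> measurable_fun setT f.
Proof. by case. Qed.

Local Hint Extern 0 (measurable_fun _ _) =>
  solve [eapply heart_measurable; eassumption] : core.

Lemma heart_modular f m : H f -> 0 < m -> exists2 c, 0 <= c & M f m = c%:E.
Proof.
move=> [_ /[apply]]; have := modular_ge0 f m.
by case: (M f m) => // c; rewrite lee_fin => c0 _; exists c.
Qed.

(** The Orlicz heart is a lattice and a linear space because of this comparison. *)
Lemma heart_le_add f g h : H f -> H g -> measurable_fun setT h ->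
  {ae mu, forall x, `|h x| <= `|f x| + `|g x|} -> H h.
Proof.
move=> Hf Hg mh hfg; split=> // m m0; have m20 : 0 < m / 2 by rewrite divr_gt0.
have [c c0 cE] := heart_modular Hf m20; have [e e0 eE] := heart_modular Hg m20.
apply: (@le_lt_trans _ _
  ((1 / 2)%:E * M f (m / 2) + (1 - 1 / 2)%:E * M g (m / 2))%E); last first.
  by rewrite cE eE -!EFinM -EFinD ltry.
apply: modular_conv; rewrite //; first by lra.
apply: filterS hfg => x hx; rewrite !normrM.
have -> : `|(m / 2)^-1| = 2 * `|m^-1| by rewrite !gtr0_norm ?invr_gt0// invf_div mulrC.
have := ler_wpM2r (normr_ge0 m^-1) hx; lra.
Qed.

Lemma heart_le f h : H f -> measurable_fun setT h ->
  {ae mu, forall x, `|h x| <= `|f x|} -> H h.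
Proof.
move=> Hf mh hf; apply: (heart_le_add Hf Hf) => //.
by apply: filterS hf => x; have := normr_ge0 (f x); lra.
Qed.

Lemma heart0 : H (cst 0).
Proof.
by split=> // m m0; rewrite modular_cst0 ltry.
Qed.

Lemma heartD f g : H f -> H g -> H (f \+ g).
Proof.
move=> Hf Hg; apply: (heart_le_add Hf Hg).
  by apply: measurable_funD; exact: heart_measurable.
by apply: aeW => x; exact: ler_normD.
Qed.

Lemma heartB f g : H f -> H g -> H (f \- g).
Proof.
move=> Hf Hg; apply: (heart_le_add Hf Hg).
  by apply: measurable_funB; exact: heart_measurable.
by apply: aeW => x; exact: ler_normB.
Qed.

Lemma heartZ c f : H f -> H (fun x => c * f x).
Proof.
move=> Hf; split=> [|m m0].
  by apply: measurable_funM => //; exact: heart_measurable Hf.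
have m1 : 0 < m / (`|c| + 1) by rewrite divr_gt0// ltr_wpDl.
have [_ /(_ _ m1)] := Hf; apply: le_lt_trans; apply: le_modular.
- exact: heart_measurable Hf.
- by apply: measurable_funM => //; exact: heart_measurable Hf.
apply: aeW => x; rewrite invf_div mulrA mulrAC !normrM.
rewrite [`|c| * _ * _]mulrC mulrA ler_wpM2r// ler_wpM2l//.
by rewrite [leRHS]ger0_norm ?addr_ge0// lerDl.
Qed.

Lemma heart_norm f : H f -> H (fun x => `|f x|).
Proof.
move=> Hf; apply: (heart_le Hf); last by apply: aeW => x; rewrite normr_id.
by apply: measurableT_comp => //; exact: heart_measurable.
Qed.

Lemma heartN f : H f -> H (\- f).
Proof.
move=> Hf; apply: (heart_le Hf); last by apply: aeW => x; rewrite normrN.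
by apply: measurableT_comp => //; exact: heart_measurable.
Qed.

Lemma luxemburg_ge0 rho f : 0 <= lux rho f.
Proof.
rewrite /luxemburg; set A := [set m | _]; have [->|/set0P A0] := eqVneq A set0.
  by rewrite inf0.
by apply: lb_le_inf => // m [/ltW].
Qed.

Lemma luxemburg_le rho f m : 0 < m -> (M f m <= rho%:E)%E -> lux rho f <= m.
Proof. by move=> m0 fm; apply: ge_inf => //; exists 0 => n [/ltW]. Qed.

Lemma luxemburg_set0 rho f : 1 <= rho -> H f ->
  [set m | 0 < m /\ (M f m <= rho%:E)%E] !=set0.
Proof.
move=> rho1 Hf; have [c c0 cE] := heart_modular Hf ltr01.
have c1 : 0 < c + 1 by rewrite ltr_wpDl.
exists (c + 1); split=> //.
apply: le_trans (_ : ((c + 1)^-1%:E * M f 1 <= _)%E).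
  apply: modular_scale => //.
    by rewrite invr_ge0 ltW//= invf_le1// lerDr.
  by apply: aeW => x; rewrite divr1 normrM mulrC gtr0_norm ?invr_gt0.
rewrite cE -EFinM lee_fin mulrC (le_trans _ rho1)// ler_pdivrMr// mul1r lerDl//.
Qed.

Lemma luxemburg_lt_modular rho f m : 1 <= rho -> H f -> lux rho f < m ->
  (M f m <= rho%:E)%E.
Proof.
move=> rho1 Hf /(inf_lt (luxemburg_set0 rho1 Hf))[n [n0 fn] nm]; apply: le_trans fn.
apply: le_modular => //.
apply: aeW => x; rewrite !normrM ler_wpM2l// !gtr0_norm ?invr_gt0//.
  by rewrite lef_pV2 ?posrE ?(lt_trans n0 nm)// ltW.
exact: lt_trans nm.
Qed.

End modular.

(** * The Luxemburg norm *)

Local Opaque luxemburg.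

Section luxemburg_norm.
Context {R : realType} {d : nat} {phi : R -> R} (hphi : young_generator phi).
Implicit Types (f g h : 'rV[R]_d -> R) (m p q t rho c : R).
Local Notation mu := (lebesgue_rV R d).
Local Notation M := (@modular R d phi).
Local Notation H := (@orlicz_heart R d phi).
Local Notation lux := (@luxemburg R d phi).

Local Hint Extern 0 (measurable_fun _ _) =>
  solve [eapply heart_measurable; eassumption] : core.

(** The infimum in the Luxemburg norm is attained: by convexity, [f / m] is a
convex combination of [f / n] for [n > m] close to [m] and of [f / (m / 2)],
and the weight of the latter, whose modular is finite, tends to [0]. *)
Lemma luxemburg_leP rho f m : 1 <= rho -> H f -> 0 < m ->
  lux rho f <= m <-> (M f m <= rho%:E)%E.
Proof.
move=> rho1 Hf m0; split=> [fm|]; last exact: luxemburg_le.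
have [c c0 cE] := heart_modular hphi Hf m0.
have [k k0 kE] := heart_modular hphi Hf (divr_gt0 m0 (ltr0Sn R 1)).
rewrite cE lee_fin; apply/ler_addgt0Pr => e e0.
pose s := e / (2 * (e + k + 1)).
have D0 : 0 < 2 * (e + k + 1) by lra.
have s0 : 0 < s by rewrite divr_gt0.
have s1 : s < 1 / 2 by rewrite ltr_pdivrMr//; lra.
have se : s * k <= e by rewrite /s mulrAC ler_pdivrMr// ler_pM2l//; lra.
have s2 : 0 < 1 - 2 * s by lra.
have s3 : (0 <= (1 - s)%:E)%E by rewrite lee_fin; lra.
pose n := m * (1 - s) / (1 - 2 * s).
have mn : m < n by rewrite ltr_pdivlMr// ltr_pM2l//; lra.
have n0 := lt_trans m0 mn.
have fn : (M f n <= rho%:E)%E.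
  exact: (luxemburg_lt_modular hphi rho1 Hf (le_lt_trans fm mn)).
suff : (M f m <= (1 - s)%:E * M f n + (1 - (1 - s))%:E * M f (m / 2))%E.
  move=> /le_trans/(_ (leeD2r _ (lee_wpmul2l s3 fn))); rewrite kE cE.
  rewrite -!EFinM -EFinD lee_fin => cs.
  by apply: (le_trans cs); nra.
apply: (modular_conv hphi) => //; first by lra.
apply: aeW => x; rewrite !normrM !mulrA -![in leRHS](mulrC `|f x|) -!mulrA -mulrDr.
rewrite ler_wpM2l// !gtr0_norm ?invr_gt0// ?divr_gt0//.
rewrite le_eqVlt; apply/orP; left; apply/eqP; rewrite /n.
field; rewrite !gt_eqF//; lra.
Qed.

Lemma luxemburg_le_gt rho f c : 0 <= c ->
  (forall m, c < m -> (M f m <= rho%:E)%E) -> lux rho f <= c.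
Proof.
move=> c0 fc; apply/ler_addgt0Pr => e e0; have ce : c < c + e by rewrite ltrDl.
by apply: luxemburg_le; [exact: le_lt_trans ce|exact: fc].
Qed.

(** For [p] and [q] slightly above the norms of [f] and [g], [h / (p + q)] is
dominated by the convex combination of [f / p] and [g / q] with weights
[p / (p + q)] and [q / (p + q)]. *)
Lemma luxemburg_le_add rho f g h : 1 <= rho -> H f -> H g ->
  measurable_fun setT h -> {ae mu, forall x, `|h x| <= `|f x| + `|g x|} ->
  lux rho h <= lux rho f + lux rho g.
Proof.
move=> rho1 Hf Hg mh hfg; apply: luxemburg_le_gt; first by rewrite addr_ge0 ?luxemburg_ge0.
have slack (a b m : R) : 0 <= a -> 0 <= b -> a + b < m ->
    exists p q, [/\ a < p, b < q, 0 < p, 0 < q & m = p + q].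
  by move=> *; exists (a + (m - a - b) / 2), (b + (m - a - b) / 2); split; lra.
move=> m /(slack _ _ _ (luxemburg_ge0 _ _) (luxemburg_ge0 _ _))[p [q [fp gq p0 q0 mE]]].
have {}fp := luxemburg_lt_modular hphi rho1 Hf fp.
have {}gq := luxemburg_lt_modular hphi rho1 Hg gq.
have m0 : 0 < m by rewrite mE addr_gt0.
pose t := p / m.
have tE : 1 - t = q / m.
  by rewrite /t -{1}(divff (lt0r_neq0 m0)) -mulrBl {1}mE addrAC subrr add0r.
have t0 : 0 < t by rewrite divr_gt0.
have t1 : 0 < 1 - t by rewrite tE divr_gt0.
have t0E : (0 <= t%:E)%E by rewrite lee_fin ltW.
have t1E : (0 <= (1 - t)%:E)%E by rewrite lee_fin ltW.
suff : (M h m <= t%:E * M f p + (1 - t)%:E * M g q)%E.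
  move=> /le_trans; apply; have -> : (rho%:E = t%:E * rho%:E + (1 - t)%:E * rho%:E)%E.
    by rewrite -!EFinM -EFinD; congr EFin; ring.
  exact: (leeD (lee_wpmul2l t0E fp) (lee_wpmul2l t1E gq)).
apply: (modular_conv hphi) => //; first by rewrite (ltW t0) -subr_ge0 ltW.
apply: filterS hfg => x hx; rewrite !normrM tE /t.
rewrite (mulrCA _ `|f x|) (mulrCA _ `|g x|) !(gtr0_norm (_ : 0 < _^-1)) ?invr_gt0//.
rewrite ![_ / m * _]mulrAC !mulfV ?gt_eqF// !mul1r -mulrDl.
by rewrite ler_wpM2r// invr_ge0 ltW.
Qed.

Lemma luxemburg0 rho : 1 <= rho -> lux rho (cst 0) = 0.
Proof.
move=> rho1; apply/eqP; rewrite eq_le luxemburg_ge0 andbT luxemburg_le_gt// => m m0.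
by rewrite modular_cst0 lee_fin (le_trans _ rho1).
Qed.

Lemma le_luxemburg rho f h : 1 <= rho -> H f -> measurable_fun setT h ->
  {ae mu, forall x, `|h x| <= `|f x|} -> lux rho h <= lux rho f.
Proof.
move=> rho1 Hf mh hf; rewrite -[leRHS]addr0 -[X in _ + X](luxemburg0 rho1).
apply: luxemburg_le_add => //; first exact: heart0.
by apply: filterS hf => x; rewrite normr0 addr0.
Qed.

Lemma luxemburg_ae_eq rho f h : 1 <= rho -> H f -> H h -> ae_equal f h ->
  lux rho f = lux rho h.
Proof.
move=> rho1 Hf Hh fh; apply/eqP.
by rewrite eq_le !le_luxemburg//; apply: filterS fh => x ->.
Qed.

Lemma luxemburgZ_le rho c f : 1 <= rho -> H f ->
  lux rho (fun x => c * f x) <= `|c| * lux rho f.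
Proof.
move=> rho1 Hf; have [->|c0] := eqVneq c 0.
  rewrite normr0 mul0r -[leRHS](luxemburg0 rho1) le_luxemburg//; first exact: heart0.
    exact: (heart_measurable (heartZ hphi 0 Hf)).
  by apply: aeW => x; rewrite mul0r normr0.
have c1 : 0 < `|c| by rewrite normr_gt0.
apply: luxemburg_le_gt => [|m]; first by rewrite mulr_ge0 ?luxemburg_ge0.
rewrite mulrC -ltr_pdivlMr// => /(luxemburg_lt_modular hphi rho1 Hf); apply: le_trans.
apply: (le_modular hphi) => //.
  by apply: measurable_funM => //; exact: heart_measurable.
by apply: aeW => x; rewrite invf_div !normrM normr_id mulrA (mulrC `|c|).
Qed.

Lemma luxemburgZ rho c f : 1 <= rho -> H f ->
  lux rho (fun x => c * f x) = `|c| * lux rho f.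
Proof.
move=> rho1 Hf; apply/eqP; rewrite eq_le luxemburgZ_le//=.
have [->|c0] := eqVneq c 0; first by rewrite normr0 mul0r luxemburg_ge0.
rewrite -ler_pdivlMl ?normr_gt0// -normfV.
apply: le_trans (luxemburgZ_le c^-1 rho1 (heartZ hphi c Hf)).
rewrite le_luxemburg//; first by apply: (heartZ hphi); exact: (heartZ hphi).
by apply: aeW => x; rewrite mulKf.
Qed.

Lemma luxemburg_norm_anti rho f : 1 <= rho -> H f -> lux rho (\- f) = lux rho f.
Proof.
move=> rho1 Hf; apply/eqP; have HN := heartN hphi Hf.
by rewrite eq_le !le_luxemburg//; apply: aeW => x; rewrite normrN.
Qed.

Lemma luxemburgBC rho f g : 1 <= rho -> H f -> H g -> lux rho (f \- g) = lux rho (g \- f).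
Proof.
move=> rho1 Hf Hg; rewrite -luxemburg_norm_anti//; last exact: (heartB hphi).
by congr (lux _ _); apply/funext => x /=; rewrite opprB.
Qed.

Lemma luxemburg_triangle rho f g h : 1 <= rho -> H f -> H g -> H h ->
  lux rho (f \- h) <= lux rho (f \- g) + lux rho (g \- h).
Proof.
move=> rho1 Hf Hg Hh; apply: luxemburg_le_add => //; first exact: (heartB hphi).
- exact: (heartB hphi).
- exact: (heart_measurable (heartB hphi Hf Hh)).
- by apply: aeW => x; exact: ler_distD.
Qed.

Lemma luxemburg_le_dist rho f g : 1 <= rho -> H f -> H g ->
  lux rho f <= lux rho (f \- g) + lux rho g.
Proof.
move=> rho1 Hf Hg; have HB := heartB hphi Hf Hg; apply: luxemburg_le_add => //.
by apply: aeW => x /=; rewrite -{1}(subrK (g x) (f x)) ler_normD.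
Qed.

Lemma le_luxemburg_rho rho f : 1 <= rho -> H f -> lux rho f <= lux 1 f.
Proof.
move=> rho1 Hf; apply: luxemburg_le_gt => [|m fm]; first exact: luxemburg_ge0.
by apply: le_trans (luxemburg_lt_modular hphi _ Hf fm) _; rewrite ?lee_fin.
Qed.

(** By convexity, enlarging the scale by the factor [rho] divides the modular by at
least [rho]. *)
Lemma luxemburg_le_rho rho f : 1 <= rho -> H f -> lux 1 f <= rho * lux rho f.
Proof.
move=> rho1 Hf; have rho0 : 0 < rho by exact: lt_le_trans rho1.
apply: luxemburg_le_gt => [|m]; first by rewrite mulr_ge0 ?luxemburg_ge0 ?ltW.
rewrite mulrC -ltr_pdivlMr// => /(luxemburg_lt_modular hphi rho1 Hf) fm.
apply: (@le_trans _ _ (rho^-1%:E * M f (m / rho))%E); last first.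
  by rewrite muleC lee_pdivrMr// mul1e.
apply: (modular_scale hphi) => //.
  by rewrite invr_ge0 ltW//= invf_le1.
apply: aeW => x; rewrite invf_div mulrCA normrM [in leRHS]normrM.
by rewrite (gtr0_norm rho0) mulKf ?normrM// gt_eqF.
Qed.

(** If [f] has norm [0] then [M f e <= 1] for every [e], while [M f 1 <= e * M f e] by
convexity; hence [M f 1 = 0]. *)
Lemma luxemburg_eq0 f : H f -> lux 1 f = 0 -> ae_equal f (cst 0).
Proof.
move=> Hf f0.
have fk e : 0 < e -> (M f 1 <= e%:E)%E.
  move=> e0; wlog e1 : e e0 / e <= 1.
    move=> W; have [/W|] := leP e 1; first exact.
    by move=> /ltW e1; apply: le_trans (W 1 _ _) _; rewrite ?lee_fin.
  have fe : (M f e <= 1%:E)%E by apply/luxemburg_leP; rewrite ?f0// ltW.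
  apply: (@le_trans _ _ (e%:E * M f e)%E); last first.
    by rewrite -[leRHS]mule1 lee_wpmul2l// lee_fin ltW.
  apply: (modular_scale hphi); rewrite ?e1 ?ltW//.
  apply: aeW => x; rewrite divr1 normrM (gtr0_norm (_ : 0 < e^-1)) ?invr_gt0//.
  by rewrite mulrCA mulfV ?gt_eqF// mulr1.
have f10 : (M f 1 = 0)%E.
  apply/eqP; rewrite eq_le (modular_ge0 hphi) andbT; apply/lee_addgt0Pr => e e0.
  by rewrite add0e fk.
have m1 := measurable_modular_integrand hphi 1 (heart_measurable Hf).
have /(ae_eq_integral_abs mu measurableT m1) :
    (\int[mu]_x `|(young phi (f x / 1))%:E| = 0)%E.
  by rewrite -f10; apply: eq_integral => x _; rewrite gee0_abs// lee_fin young_nonneg.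
apply: filterS => x /(_ I) [] fx0; apply/eqP/negPn/negP => /(young_gt0 hphi).
by rewrite -(divr1 (f x)) fx0 ltxx.
Qed.
End luxemburg_norm.

(** * Measurability and translation invariance on R^d *)

Section measurability_rV.
Context {R : realType}.

Lemma continuous_measurable_rV n (f : 'rV[R]_n -> R) :
  continuous f -> measurable_fun setT f.
Proof.
move=> cf; apply: (measurability _ (RGenOpens.measurableE R)) => //.
move=> _ [_ [x [y ->]] <-]; rewrite setTI; apply: open_mx_measurable.
by apply: open_comp; [move=> w _; exact: cf|exact: interval_open].
Qed.

Lemma measurable_coord_rV n (i : 'I_n) :
  measurable_fun setT (fun x : 'rV[R]_n => x ord0 i).
Proof. by apply: continuous_measurable_rV => x; exact: coord_continuous. Qed.

Lemma cons_rv_lift n (y : R) (x : 'rV[R]_n) j :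
  cons_rv (y, x) ord0 (lift ord0 j) = x ord0 j.
Proof. by have /rowP/(_ j) := behead_cons_rv y x; rewrite mxE. Qed.

(** The Borel sets of [R^n] are generated by the coordinates because
[R^n.+1] carries the product structure, through [cons_rv]. *)
Lemma measurable_fun_rV disp (T : measurableType disp) n (F : T -> 'rV[R]_n) :
  (forall i, measurable_fun setT (fun w => F w ord0 i)) -> measurable_fun setT F.
Proof.
elim: n F => [F _|n IHn F mF].
  have -> : F = cst 0 by apply/funext => w; apply/rowP; case.
  exact: measurable_cst.
have -> : F = cons_rv (n := n) \o (fun w => (F w ord0 ord0, behead_rv (F w))).
  apply/funext => w; apply/rowP => i /=.
  have [j ->|->] := unliftP ord0 i; last by rewrite head_cons_rv.
  by rewrite cons_rv_lift mxE.
apply: measurableT_comp; first exact: measurable_cons_rv.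
apply: measurable_fun_pair; first exact: mF.
by apply: IHn => i; under eq_fun do rewrite mxE; exact: mF.
Qed.

Lemma measurable_addr_rV n (v : 'rV[R]_n) :
  measurable_fun setT (fun x : 'rV[R]_n => x + v).
Proof.
apply: measurable_fun_rV => i; under eq_fun do rewrite mxE.
by apply: measurable_funD => //; exact: measurable_coord_rV.
Qed.

Lemma measurable_add_rV disp (T : measurableType disp) n (Y : T -> 'rV[R]_n) :
  measurable_fun setT Y ->
  measurable_fun setT (fun z : 'rV[R]_n * T => z.1 + Y z.2).
Proof.
move=> mY; apply: measurable_fun_rV => i; under eq_fun do rewrite mxE.
apply: measurable_funD.
  exact: (measurableT_comp (measurable_coord_rV i)).
apply: (measurableT_comp (measurable_coord_rV i)).
exact: measurableT_comp.
Qed.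

End measurability_rV.

Section translation.
Context {R : realType}.
Local Open Scope ereal_scope.

Lemma lebesgue_measure_translation (c : R) (A : set R) : measurable A ->
  pushforward lebesgue_measure ((fun x : R => x + c)%R : _ -> measurableTypeR R) A
  = lebesgue_measure A.
Proof.
move=> mA; apply/esym/lebesgue_measure_unique => //=.
  exact: measurable_funD.
move=> mc _ [[a b]] _ <-; rewrite /pushforward.
rewrite (_ : _ @^-1` _ = `](a - c)%R, (b - c)%R]%classic); last first.
  by apply/seteqP; split=> x /=; rewrite !in_itv/= ltrBlDr lerBrDr.
by rewrite !lebesgue_measure_itv/= !lte_fin ltrD2r -!EFinB opprD opprK addrACA addNr addr0.
Qed.

Lemma ge0_integral_translation1 (c : R) (f : R -> \bar R) :
  measurable_fun setT f -> (forall x, 0 <= f x) ->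
  \int[lebesgue_measure]_x f (x + c)%R = \int[lebesgue_measure]_x f x.
Proof.
move=> mf f0.
transitivity (\int[pushforward lebesgue_measure
   ((fun x : R => x + c)%R : _ -> measurableTypeR R)]_x f x).
  rewrite ge0_integral_pushforward//; first exact: measurable_funD.
apply: eq_measure_integral => [|mc A mA _]; first exact: measurable_funD.
exact: lebesgue_measure_translation.
Qed.

(** Induction on the dimension: Lebesgue measure of [R^n.+1] is the product
of those of [R] and [R^n]. *)
Lemma ge0_integral_translation n (v : 'rV[R]_n) (f : 'rV[R]_n -> \bar R) :
  measurable_fun setT f -> (forall x, 0 <= f x) ->
  \int[lebesgue_rV R n]_x f (x + v)%R = \int[lebesgue_rV R n]_x f x.
Proof.
elim: n v f => [v f mf f0|n IHn v f mf f0].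
  by apply: eq_integral => x _; congr (f _); apply/rowP; case.
have cE g : measurable_fun setT g -> (forall x, 0 <= g x) ->
    \int[lebesgue_rV R n.+1]_x g x =
    \int[lebesgue_measure]_y \int[lebesgue_rV R n]_x g (cons_rv (y, x)).
  move=> mg g0; pose k : measurableTypeR R * 'rV[R]_n -> 'rV[R]_n.+1 := cons_rv (n := n).
  have mk : measurable_fun setT k := @measurable_cons_rv R n.
  have mgk : measurable_fun setT (g \o k) by exact: measurableT_comp mk.
  have := fubini_tonelli1 (m1 := @lebesgue_measure R) (m2 := lebesgue_rV R n)
    (g \o k) mgk (fun z => g0 (k z)).
  rewrite /fubini_F /= => <-.
  have := ge0_integral_pushforward mk (@lebesgue_measure R \x lebesgue_rV R n)
    measurableT mg (fun y _ => g0 y).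
  by rewrite preimage_setT => <-; exact: eq_measure_integral.
have consD y x : (cons_rv (y, x) + v)%R = cons_rv (y + v ord0 ord0, x + behead_rv v)%R.
  apply/rowP => i; rewrite [LHS]mxE; have [j ->|->] := unliftP ord0 i.
    by rewrite !cons_rv_lift !mxE.
  by rewrite !head_cons_rv.
have mcf y : measurable_fun setT (fun x : 'rV[R]_n => f (cons_rv (y, x))).
  apply: measurableT_comp mf _; apply: measurableT_comp; first exact: measurable_cons_rv.
  exact: measurable_fun_pair.
have mfv : measurable_fun setT (fun x : 'rV[R]_n.+1 => f (x + v)%R).
  by apply: measurableT_comp mf _; exact: measurable_addr_rV.
rewrite (cE _ mf f0) (cE _ mfv (fun x => f0 (x + v)%R)).
transitivity (\int[lebesgue_measure]_y \int[lebesgue_rV R n]_x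
    f (cons_rv (y + v ord0 ord0, x)%R)).
  apply: eq_integral => y _.
  rewrite -(IHn (behead_rv v) (fun x => f (cons_rv (y + v ord0 ord0, x)%R)))//.
  by apply: eq_integral => x _; rewrite consD.
pose F : R -> \bar R := fun y => \int[lebesgue_rV R n]_x f (cons_rv (y, x)).
have mF : measurable_fun setT F.
  apply: (measurable_fun_fubini_tonelli_F (fun z => f (cons_rv z))) => //.
  by apply: measurableT_comp mf _; exact: measurable_cons_rv.
by apply: (ge0_integral_translation1 (v ord0 ord0) mF) => y; exact: integral_ge0.
Qed.

(** Tonelli, and translation invariance of the inner integral for each fixed [w]. *)
Lemma integral_shift_rv disp (Omega : measurableType disp)
    (P : probability Omega R) n (Y : Omega -> 'rV[R]_n) (B : set Omega)
    (f : 'rV[R]_n -> \bar R) :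
  measurable_fun setT Y -> measurable B ->
  measurable_fun setT f -> (forall x, 0 <= f x) ->
  \int[lebesgue_rV R n]_x \int[P]_w (f (x + Y w)%R * (\1_B w)%:E)
  = P B * \int[lebesgue_rV R n]_x f x.
Proof.
move=> mY mB mf f0.
rewrite (fubini_tonelli (fun z : 'rV[R]_n * Omega =>
  f (z.1 + Y z.2)%R * (\1_B z.2)%:E)); last 2 first.
- apply: emeasurable_funM.
    by apply: measurableT_comp mf _; exact: measurable_add_rV.
  apply/measurable_EFinP; apply: measurableT_comp => //.
- by move=> z; rewrite mule_ge0// lee_fin.
transitivity (\int[P]_w ((\1_B w)%:E * \int[lebesgue_rV R n]_x f x)).
  apply: eq_integral => w _ /=; rewrite muleC -(ge0_integral_translation (Y w) mf f0).
  rewrite -ge0_integralZr ?lee_fin//.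
  by apply: measurableT_comp mf _; exact: measurable_addr_rV.
rewrite ge0_integralZr//; first by rewrite integral_indic// setIT.
  by apply/measurable_EFinP.
exact: integral_ge0.
Qed.

End translation.

(** * Continuous functions vanishing at infinity *)

Section bounded_functions.
Context {R : realType} {d : nat}.
Implicit Types (f g : 'rV[R]_d -> R) (x : 'rV[R]_d) (r : R).

(** Unlike [Cc_fun], stated through a bound on the support in the maximum norm,
which is the form in which the integrals are estimated. *)
Definition C00_fun : set ('rV[R]_d -> R) :=
  [set f | continuous f /\ exists r : R, forall x, r <= `|x| -> f x = 0].

Definition cball r : set 'rV[R]_d := [set x | `|x| <= r].

Lemma coord_le_norm x i : `|x ord0 i| <= `|x|.
Proof.
have /mapP[j Hj ->] : `|x ord0 i| \in [seq `|x y.1 y.2| | y : 'I_1 * 'I_d].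
  by apply/mapP; exists (ord0, i) => //=; rewrite mem_enum.
by rewrite [leRHS]/Num.Def.normr /= mx_normrE; apply/bigmax_geP; right => /=; exists j.
Qed.

Lemma norm_le_coord x r : 0 <= r -> (forall i, `|x ord0 i| <= r) -> `|x| <= r.
Proof.
move=> r0 xr; rewrite [leLHS]/Num.Def.normr /= mx_normrE.
apply/bigmax_leP; split=> // -[i j] _ /=.
by rewrite (ord1 i).
Qed.

Lemma norm_le_enorm x : `|x| <= enorm x.
Proof.
apply: norm_le_coord => [|i]; first exact: sqrtr_ge0.
rewrite -sqrtr_sqr ler_sqrt; last by apply: sumr_ge0 => j _; exact: sqr_ge0.
by rewrite (bigD1 i)//= lerDl sumr_ge0// => j _; exact: sqr_ge0.
Qed.

Lemma enorm_le_norm x : enorm x <= Num.sqrt d%:R * `|x|.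
Proof.
rewrite -[`|x|]normr_id -sqrtr_sqr -sqrtrM// ler_sqrt; last by rewrite mulr_ge0 ?sqr_ge0.
apply: le_trans (_ : \sum_(i < d) `|x| ^+ 2 <= _); last first.
  by rewrite sumr_const card_ord mulr_natl.
apply: ler_sum => i _; rewrite -[leLHS]real_normK ?num_real//.
by rewrite lerXn2r ?nnegrE// coord_le_norm.
Qed.

Lemma closed_cball r : closed (cball r).
Proof.
have -> : cball r = (fun x => `|x|) @^-1` [set y | y <= r] by [].
apply: preimage_closed; last exact: closed_le.
by move=> x _; exact: norm_continuous.
Qed.

Lemma measurable_cball r : measurable (cball r).
Proof.
rewrite -[cball r]setCK; apply: measurableC; apply: open_mx_measurable.
by apply: closed_openC; exact: closed_cball.
Qed.

Lemma lebesgue_cball r : (lebesgue_rV R d (cball r) < +oo)%E.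
Proof.
pose b : 'rV[R]_d := const_mx `|r|.
apply: (@le_lt_trans _ _ (lebesgue_rV R d
    [set x | forall i, (- b) ord0 i <= x ord0 i <= b ord0 i])).
  apply: le_measure; rewrite ?inE.
  - exact: measurable_cball.
  - exact: measurable_box_rV.
  - move=> x xr i; rewrite !mxE -ler_norml.
    by rewrite (le_trans (coord_le_norm x i))// (le_trans xr)// ler_norm.
by rewrite lebesgue_rV_box ?ltry// => i; rewrite !mxE ge0_cp.
Qed.

Lemma compact_cball r : compact (cball r).
Proof.
apply: bounded_closed_compact; last exact: closed_cball.
by exists r; split=> [|M rM x xr]; [exact: num_real|exact: le_trans xr (ltW rM)].
Qed.

Lemma continuous_bounded_cball f r : continuous f ->
  exists2 K, 0 <= K & forall x, `|x| <= r -> `|f x| <= K.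
Proof.
move=> cf; have /compact_bounded[M [_ HM]] : compact (f @` cball r).
  by apply: continuous_compact (@compact_cball r); exact: continuous_subspaceT.
exists (`|M| + 1) => [|x xr]; first by rewrite addr_ge0.
by apply: HM; [rewrite (le_lt_trans (ler_norm M))// ltrDl|exists x].
Qed.

Lemma C00_subC0 : C00_fun `<=` C0_fun.
Proof.
move=> f [cf [r fr]]; split=> // e e0; exists (Num.sqrt d%:R * (`|r| + 1) + 1) => x xr.
suff : r <= `|x| by move=> /fr ->; rewrite normr0.
rewrite leNgt; apply/negP => xr'; have := le_trans xr (enorm_le_norm x).
apply/negP; rewrite -ltNge ltr_pwDr// ler_wpM2l ?sqrtr_ge0//.
by rewrite (le_trans (ltW xr'))// (le_trans (ler_norm r))// lerDl.
Qed.

Lemma Cc_subC00 : Cc_fun `<=` C00_fun.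
Proof.
move=> f [cf /compact_bounded[M [_ HM]]]; split=> //; exists (`|M| + 2) => x Mx.
apply/eqP/negPn/negP => fx0; have : `|x| <= `|M| + 1.
  apply: HM; first by rewrite (le_lt_trans (ler_norm M))// ltrDl.
  exact: subset_closure.
by apply/negP; rewrite -ltNge; apply: lt_le_trans Mx; rewrite ltrD2l ltr1n.
Qed.

Lemma C0_fun_bounded f : C0_fun f -> exists2 K, 0 <= K & forall x, `|f x| <= K.
Proof.
move=> [cf /(_ 1 ltr01)[r fr]]; have [K K0 fK] := continuous_bounded_cball r cf.
exists (K + 1) => [|x]; first by rewrite addr_ge0.
have [xr|xr] := leP `|x| r; first by rewrite (le_trans (fK _ xr))// lerDl.
by rewrite ltW// (lt_le_trans (fr _ _))// ?lerDr// (le_trans (ltW xr))// norm_le_enorm.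
Qed.

Lemma C0_fun_measurable f : C0_fun f -> measurable_fun setT f.
Proof. by move=> [cf _]; exact: continuous_measurable_rV. Qed.

Lemma le_sup_norm f x : (exists2 K, 0 <= K & forall y, `|f y| <= K) ->
  `|f x| <= sup_norm f.
Proof.
move=> [K K0 fK]; apply: ub_le_sup; last by exists x.
by exists K => _ [y _ <-]; exact: fK.
Qed.

Lemma C0_funD f g : C0_fun f -> C0_fun g -> C0_fun (f \+ g).
Proof.
move=> [cf f0] [cg g0]; split=> [x|e e0]; first by apply: continuousD; [exact: cf|exact: cg].
have e20 : 0 < e / 2 by rewrite divr_gt0.
have [[r fr] [s gs]] := (f0 _ e20, g0 _ e20).
exists (Num.max r s) => x; rewrite ge_max => /andP[/fr fx /gs gx].
by rewrite (le_lt_trans (ler_normD _ _))// [e]splitr ltrD.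
Qed.

Lemma C0_funZ c f : C0_fun f -> C0_fun (fun x => c * f x).
Proof.
move=> [cf f0]; split=> [x|e e0]; first by apply: continuousM; [exact: cst_continuous|exact: cf].
have e20 : 0 < e / (`|c| + 1) by rewrite divr_gt0// ltr_wpDl.
have [r fr] := f0 _ e20; exists r => x /fr; rewrite ltr_pdivlMr ?ltr_wpDl//.
by apply: le_lt_trans; rewrite normrM mulrC ler_wpM2l// lerDl.
Qed.

Lemma C0_fun0 : C0_fun (cst 0 : 'rV[R]_d -> R).
Proof.
by split=> [x|e e0]; [exact: cst_continuous|exists 0 => x _; rewrite normr0].
Qed.

Lemma C00_funD f g : C00_fun f -> C00_fun g -> C00_fun (f \+ g).
Proof.
move=> [cf [r f0]] [cg [s g0]]; split=> [x|]; first by apply: continuousD; [exact: cf|exact: cg].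
by exists (Num.max r s) => x; rewrite ge_max => /andP[/f0 /= -> /g0 ->]; rewrite addr0.
Qed.

Lemma C00_funZ c f : C00_fun f -> C00_fun (fun x => c * f x).
Proof.
move=> [cf [r f0]]; split=> [x|]; first by apply: continuousM; [exact: cst_continuous|exact: cf].
by exists r => x /f0 ->; rewrite mulr0.
Qed.

End bounded_functions.

Section modular_split.
Context {R : realType} {d : nat} {phi : R -> R} (hphi : young_generator phi).
Implicit Types (f g h : 'rV[R]_d -> R) (m r K : R).
Local Notation mu := (lebesgue_rV R d).

Lemma modular_split_le f m r K c : measurable_fun setT f ->
  (forall x, `|x| <= r -> `|f x| <= K) ->
  (\int[mu]_(x in ~` cball r) (young phi (f x / m))%:E <= c)%E ->
  (modular phi f m <= (young phi (K / m))%:E * mu (cball r) + c)%E.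
Proof.
move=> mf fK fc; have mF := measurable_modular_integrand hphi m mf.
rewrite /modular -[X in (\int[mu]_(x in X) _)%E](setUv (cball r)).
rewrite ge0_integral_setU//=; first last.
- exact/disj_setPCl.
- by move=> x _; rewrite lee_fin young_nonneg.
- by rewrite setUv.
- by apply: measurableC; exact: measurable_cball.
- exact: measurable_cball.
apply: leeD => //; rewrite -integral_cst; last exact: measurable_cball.
apply: ge0_le_integral => //.
- exact: measurable_cball.
- by move=> x _; rewrite lee_fin young_nonneg.
- exact: measurable_funTS.
- move=> x /fK xK; rewrite lee_fin le_young// !normrM ler_wpM2r//.
  by rewrite (le_trans xK)// ler_norm.
Qed.

Lemma C00_heart : C00_fun `<=` @orlicz_heart R d phi.
Proof.
move=> f [cf [r fr]]; have mf := continuous_measurable_rV cf.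
split=> // m m0; have [K K0 fK] := continuous_bounded_cball r cf.
apply: le_lt_trans (@modular_split_le f m r K 0%E mf fK _) _.
  rewrite integral0_eq// => x /= /negP; rewrite -ltNge => /ltW/fr ->.
  by rewrite mul0r young0.
rewrite adde0 lte_mul_pinfty ?lee_fin ?young_nonneg//.
exact: lebesgue_cball.
Qed.

End modular_split.

(** * Density of continuous functions with bounded support *)

Section borel_generator.
Context {R : realType} {d : nat}.

Definition positivity_sets : set (set 'rV[R]_d) :=
  [set A | exists2 u : 'rV[R]_d -> R, continuous u & A = [set x | 0 < u x]].

Lemma open_positivity_set (u : 'rV[R]_d -> R) : continuous u -> open [set x | 0 < u x].
Proof.
move=> cu; have -> : [set x | 0 < u x] = u @^-1` [set y | 0 < y] by [].
by apply: open_comp; [move=> x _; exact: cu|exact: open_gt].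
Qed.

(** Borel sets belong to the sigma-algebra generated by the positivity sets because
the coordinates, hence the identity, are measurable for that sigma-algebra. *)
Lemma borel_positivity_sets : @measurable _ 'rV[R]_d = <<s positivity_sets >>.
Proof.
apply/seteqP; split=> [A mA|]; last first.
  apply: smallest_sub; first exact: sigma_algebra_measurable.
  by move=> _ [u cu ->]; apply: open_mx_measurable; exact: open_positivity_set.
have mid : measurable_fun setT
    (id : g_sigma_algebraType positivity_sets -> 'rV[R]_d).
  apply: measurable_fun_rV => i.
  apply: (measurability _ (RGenOInfty.measurableE R)) => //.
  move=> _ [_ [y ->] <-]; rewrite setTI; apply: sub_sigma_algebra.
  exists (fun x => x ord0 i - y).
    by move=> x; apply: continuousB; [exact: coord_continuous|exact: cst_continuous].
  by apply/seteqP; split=> x /=; rewrite in_itv/= andbT subr_gt0.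
by have := mid measurableT A mA; rewrite setTI.
Qed.

Lemma positivity_setsI : setI_closed positivity_sets.
Proof.
move=> _ _ [u cu ->] [v cv ->]; exists (u \min v).
  by move=> x; apply: continuous_min; [exact: cu|exact: cv].
by apply/seteqP; split=> x /=; rewrite lt_min => /andP.
Qed.

End borel_generator.

Section density.
Context {R : realType} {d : nat} {phi : R -> R} (hphi : young_generator phi).
Implicit Types (f g h : 'rV[R]_d -> R) (A : set 'rV[R]_d).
Local Notation mu := (lebesgue_rV R d).
Local Notation M := (@modular R d phi).
Local Notation H := (@orlicz_heart R d phi).
Local Notation lux := (@luxemburg R d phi 1).

Lemma young_cvg0 (u : nat -> R) : u @ \oo --> 0 -> young phi (u n) @[n --> \oo] --> 0.
Proof.
move=> u0.
apply: (@squeeze_cvgr _ _ _ _ (fun=> 0) (fun n => `|u n| * young phi 1)).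
- near=> n; rewrite young_nonneg//= -(young_norm (u n)) -{1}[`|u n|]mulr1.
  apply: young_scale => //; rewrite normr_ge0/=; near: n.
  by have /cvgr0_norm_le := u0; apply.
- exact: cvg_cst.
- rewrite -[X in _ --> X](mul0r (young phi 1)); apply: cvgMl.
  by rewrite -[X in _ --> X](@normr0 _ R); exact: cvg_norm.
Unshelve. all: by end_near. Qed.

(** The modular of [h] is finite at every scale, and [young phi (h / (e / 2))] dominates
[young phi ((f - f_ n) / e)]. *)
Lemma heart_dominated_cvg (f_ : nat -> 'rV[R]_d -> R) f h : H h ->
  (forall n, measurable_fun setT (f_ n)) -> (forall n x, `|f_ n x| <= `|h x|) ->
  (forall x, f_ n x @[n --> \oo] --> f x) ->
  H f /\ forall e, 0 < e -> exists n, lux (f \- f_ n) <= e.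
Proof.
move=> Hh mf_ fh ff.
have mf : measurable_fun setT f.
  by apply: measurable_fun_cvg => [n|x _]; [exact: mf_|exact: ff].
have fh' x : `|f x| <= `|h x|.
  have cf : `|f_ n x| @[n --> \oo] --> `|f x| by apply: cvg_norm; exact: ff.
  by apply: (ler_cvg_to cf (cvg_cst `|h x|)); apply: nearW => n; exact: fh.
have Hf : H f by apply: (heart_le hphi Hh) => //; exact: aeW.
split=> // e e0.
have mB n : measurable_fun setT (f \- f_ n) by exact: measurable_funB.
have [] := @dominated_convergence _ _ R mu setT measurableT
  (fun n x => (young phi ((f \- f_ n) x / e))%:E) (cst 0%E)
  (fun x => (young phi (h x / (e / 2)))%:E).
- by move=> n; exact: measurable_modular_integrand.
- exact: measurable_cst.
- apply: aeW => x _; apply/fine_cvgP; split; first exact: nearW.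
  apply: young_cvg0; rewrite -[X in _ --> X](mul0r e^-1); apply: cvgMl.
  by rewrite -[X in _ --> X](subrr (f x)); apply: cvgB; [exact: cvg_cst|exact: ff].
- apply/integrableP; split.
    by apply: measurable_modular_integrand => //; exact: heart_measurable Hh.
  under eq_integral do rewrite gee0_abs ?lee_fin ?young_nonneg//.
  by apply: Hh.2; rewrite divr_gt0.
- apply: aeW => x n _; rewrite gee0_abs ?lee_fin ?young_nonneg// le_young//.
  rewrite !normrM invf_div (le_trans (ler_wpM2r _ (ler_normB _ _)))//.
  rewrite (normrM 2) (ger0_norm (_ : 0 <= 2))// mulrA ler_wpM2r// mulr_natr mulr2n.
  exact: lerD.
move=> _ _; rewrite integral0 => cM.
have /cM[N _ /(_ N)] : nbhs 0%E [set y : \bar R | (y < 1%:E)%E].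
  by apply: open_nbhs_nbhs; split; [exact: open_ereal_lt_ereal|rewrite /= lte_fin].
move=> /(_ (leqnn N)) MN; exists N.
by apply: luxemburg_le => //; exact: ltW.
Qed.

Definition C00_closure : set ('rV[R]_d -> R) :=
  [set f | H f /\ forall e, 0 < e -> exists2 g, C00_fun g & lux (f \- g) <= e].

Lemma C00_sub_closure : C00_fun `<=` C00_closure.
Proof.
move=> f Cf; have Hf := C00_heart hphi Cf; split=> // e e0; exists f => //.
have -> : f \- f = cst 0 by apply/funext => x /=; rewrite subrr.
by rewrite luxemburg0// ltW.
Qed.

Lemma C00_closureD f g : C00_closure f -> C00_closure g -> C00_closure (f \+ g).
Proof.
move=> [Hf Cf] [Hg Cg]; split; first exact: heartD.
move=> e e0; have e20 : 0 < e / 2 by rewrite divr_gt0.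
have [[u Cu fu] [v Cv gv]] := (Cf _ e20, Cg _ e20).
exists (u \+ v); first exact: C00_funD.
rewrite [e]splitr; apply: le_trans (lerD fu gv).
have [Hu Hv] := (C00_heart hphi Cu, C00_heart hphi Cv).
have [H1 H2] := (heartB hphi Hf Hu, heartB hphi Hg Hv).
apply: luxemburg_le_add => //.
  exact: (heart_measurable (heartB hphi (heartD hphi Hf Hg) (heartD hphi Hu Hv))).
by apply: aeW => x /=; rewrite opprD addrACA; exact: ler_normD.
Qed.

Lemma C00_closureZ c f : C00_closure f -> C00_closure (fun x => c * f x).
Proof.
move=> [Hf Cf]; split; first exact: heartZ.
move=> e e0; have e20 : 0 < e / (`|c| + 1) by rewrite divr_gt0// ltr_wpDl.
have [u Cu fu] := Cf _ e20; exists (fun x => c * u x); first exact: C00_funZ.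
have -> : (fun x => c * f x) \- (fun x => c * u x) = (fun x => c * (f \- u) x).
  by apply/funext => x /=; rewrite mulrBr.
have HB := heartB hphi Hf (C00_heart hphi Cu).
rewrite luxemburgZ//; move: fu; rewrite ler_pdivlMr ?ltr_wpDl//.
by apply: le_trans; rewrite mulrC ler_wpM2l ?luxemburg_ge0// lerDl.
Qed.

Lemma C00_closureB f g : C00_closure f -> C00_closure g -> C00_closure (f \- g).
Proof.
move=> Cf Cg; have -> : f \- g = f \+ (fun x => -1 * g x).
  by apply/funext => x /=; rewrite mulN1r.
exact: (C00_closureD Cf (C00_closureZ (-1) Cg)).
Qed.

Lemma C00_closure_dominated (f_ : nat -> 'rV[R]_d -> R) f h : H h ->
  (forall n, C00_closure (f_ n)) -> (forall n x, `|f_ n x| <= `|h x|) ->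
  (forall x, f_ n x @[n --> \oo] --> f x) -> C00_closure f.
Proof.
move=> Hh Vf fh ff.
have [|Hf cf] := heart_dominated_cvg Hh _ fh ff; first by move=> n; case: (Vf n) => -[].
split=> // e e0; have e20 : 0 < e / 2 by rewrite divr_gt0.
have [n fn] := cf _ e20; have [Hfn /(_ _ e20)[g Cg fg]] := Vf n; exists g => //.
rewrite [e]splitr; apply: le_trans (lerD fn fg).
by apply: luxemburg_triangle => //; exact: C00_heart.
Qed.

Definition cutoff (k : nat) : 'rV[R]_d -> R :=
  fun x => Num.max 0 (Num.min 1 (k%:R + 1 - `|x|)).

Lemma cutoff_ge0 k x : 0 <= cutoff k x.
Proof. by rewrite /cutoff le_max lexx. Qed.

Lemma cutoff_le1 k x : cutoff k x <= 1.
Proof. by rewrite /cutoff ge_max ler01 ge_min lexx. Qed.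

Lemma cutoff_eq1 k x : `|x| <= k%:R -> cutoff k x = 1.
Proof.
move=> xk; rewrite /cutoff (min_idPl _); first exact/max_idPr.
by rewrite lerBrDr addrC lerD2r.
Qed.

Lemma cutoff_C00 k : C00_fun (cutoff k).
Proof.
split.
  rewrite (_ : cutoff k = cst 0 \max (cst 1 \min (fun x => k%:R + 1 - `|x|)))// => x.
  apply: continuous_max; first exact: cst_continuous.
  apply: continuous_min; first exact: cst_continuous.
  by apply: continuousB; [exact: cst_continuous|exact: norm_continuous].
exists (k%:R + 1) => x kx; apply/max_idPl; rewrite ge_min.
by rewrite subr_le0 kx orbT.
Qed.

Lemma cutoff_cvg1 x : cutoff k x @[k --> \oo] --> (1 : R).
Proof.
apply: cvg_near_cst; near=> k; apply: cutoff_eq1; near: k.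
exact: nbhs_infty_ger.
Unshelve. all: by end_near. Qed.

(** The cutoff puts the indicator of any measurable set into the Orlicz heart. The
indicator of a positivity set is a limit of continuous functions, and the sets for
which the claim holds form a Dynkin class. *)
Lemma C00_closure_indic A k : measurable A ->
  C00_closure (fun x => \1_A x * cutoff k x).
Proof.
rewrite borel_positivity_sets => sA; move: A sA k.
have Hk k : H (cutoff k) by apply: C00_heart => //; exact: cutoff_C00.
have leX (y : R) k x : 0 <= y <= 1 -> `|y * cutoff k x| <= `|cutoff k x|.
  by move=> /andP[y0 y1]; rewrite normrM ler_piMl// ger0_norm.
apply: (dynkin_induction (@borel_positivity_sets R d) (@positivity_setsI R d)).
- move=> k; rewrite (_ : (fun _ => _) = cutoff k); first exact/C00_sub_closure/cutoff_C00.
  by apply/funext => x; rewrite indicT mul1r.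
- move=> _ [u cu ->] k.
  pose v n := fun x => Num.min 1 (Num.max 0 (n%:R * u x)).
  have v01 n x : 0 <= v n x <= 1.
    by rewrite /v le_min ler01 le_max lexx ge_min lexx.
  apply: (@C00_closure_dominated (fun n x => v n x * cutoff k x) _ (cutoff k)) => //.
  + move=> n; apply: C00_sub_closure; have [ck [r kr]] := cutoff_C00 k.
    split=> [x|]; last by exists r => x /kr ->; rewrite mulr0.
    apply: continuousM; last exact: ck.
    rewrite (_ : v n = cst 1 \min (cst 0 \max (fun x => n%:R * u x)))//.
    apply: continuous_min; first exact: cst_continuous.
    apply: continuous_max; first exact: cst_continuous.
    by apply: continuousM; [exact: cst_continuous|exact: cu].
  + by move=> n x; exact: leX.
  + move=> x; apply: cvgMl; rewrite indicE; have [ux|ux] := ltP 0 (u x).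
      rewrite mem_set//; apply: cvg_near_cst; near=> n; apply/min_idPl.
      rewrite le_max -ler_pdivrMr// div1r; apply/orP; right; near: n.
      exact: nbhs_infty_ger.
    rewrite memNset/=; last by apply/negP; rewrite -leNgt.
    apply: cvg_near_cst; apply: nearW => n; rewrite /v (max_idPl _).
      by apply/min_idPr.
    by rewrite mulr_ge0_le0.
- move=> A _ VA k; rewrite (_ : (fun _ => _) = cutoff k \- (fun x => \1_A x * cutoff k x)).
    by apply: C00_closureB => //; exact/C00_sub_closure/cutoff_C00.
  apply/funext => x /=; rewrite indicC indicE; case: (x \in A).
    by rewrite mul0r mul1r subrr.
  by rewrite mul0r mul1r subr0.
move=> F _ tF VF k.
pose U n : set 'rV[R]_d := [set x | exists2 i, (i < n)%N & F i x].
have VU n : C00_closure (fun x => \1_(U n) x * cutoff k x).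
  elim: n => [|n IHn].
    rewrite (_ : (fun _ => _) = (fun x => 0 * cutoff k x)).
      exact/C00_closureZ/C00_sub_closure/cutoff_C00.
    by apply/funext => x; rewrite indicE memNset// => -[].
  rewrite (_ : (fun _ => _) =
      (fun x => \1_(U n) x * cutoff k x) \+ (fun x => \1_(F n) x * cutoff k x)).
    exact: (C00_closureD IHn (VF n k)).
  apply/funext => x /=; rewrite -mulrDl; congr (_ * _); rewrite !indicE.
  have [Fn|Fn] := pselect (F n x).
    rewrite (mem_set Fn) mem_set; last by exists n.
    rewrite memNset ?add0r// => -[i ni Fi].
    by have := tF i n I I (ex_intro _ x (conj Fi Fn)) => ni'; rewrite ni' ltnn in ni.
  rewrite (memNset Fn) addr0; congr (_%:R); congr nat_of_bool.
  apply/idP/idP => /set_mem[i ni Fi]; apply/mem_set; exists i => //.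
    by move: ni; rewrite ltnS leq_eqVlt => /predU1P[iE|//]; rewrite iE in Fi.
  exact: ltnW.
apply: (@C00_closure_dominated _ _ (cutoff k) (Hk k) VU).
- by move=> n x; apply: leX; rewrite indicE; case: (_ \in _); rewrite ?lexx ler01.
- move=> x; apply: cvgMl; rewrite !indicE.
  have [[i _ Fi]|nF] := pselect ((\bigcup_k0 F k0) x).
    rewrite mem_set; last by exists i.
    apply: cvg_near_cst; near=> n; rewrite indicE mem_set//; exists i => //.
    by near: n; exact: nbhs_infty_gt.
  rewrite memNset//; apply: cvg_near_cst; apply: nearW => n.
  by rewrite indicE memNset// => -[i _ Fi]; apply: nF; exists i.
Unshelve. all: by end_near. Qed.

Import HBNNSimple.

(** Simple functions increasing to [f], multiplied by cutoffs, converge to [f] and are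
dominated by [f]. *)
Lemma C00_closure_ge0 f : H f -> (forall x, 0 <= f x) -> C00_closure f.
Proof.
move=> Hf f0; have mf : measurable_fun setT (EFin \o f).
  by apply/measurable_EFinP; exact: heart_measurable Hf.
pose s := nnsfun_approx measurableT mf.
have sf n x : s n x <= f x.
  rewrite -lee_fin nnsfun_approxE; apply: le_approx => // y _.
  by rewrite lee_fin.
apply: (@C00_closure_dominated (fun n x => s n x * cutoff n x) _ f) => //.
- move=> n; rewrite (_ : (fun _ => _) = fun x =>
     \sum_(y <- finmap.enum_fset (fset_set (range (s n)))) y * (\1_(s n @^-1` [set y]) x * cutoff n x)); last first.
    apply/funext => x; rewrite fimfunE fsbig_finite//= mulr_suml.
    by apply: eq_bigr => y _; rewrite mulrA.
  elim: (finmap.enum_fset _) => [|y l IHl].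
    rewrite (_ : (fun _ => _) = fun x => 0 * cutoff n x).
      exact/C00_closureZ/C00_sub_closure/cutoff_C00.
    by apply/funext => x; rewrite big_nil mul0r.
  rewrite (_ : (fun _ => _) = (fun x => y * (\1_(s n @^-1` [set y]) x * cutoff n x))
     \+ (fun x => \sum_(y <- l) y * (\1_(s n @^-1` [set y]) x * cutoff n x))).
    apply: (fun C => C00_closureD C IHl).
    by apply: C00_closureZ; exact: C00_closure_indic.
  by apply/funext => x /=; rewrite big_cons.
- move=> n x; rewrite normrM !ger0_norm ?cutoff_ge0//.
  by rewrite (le_trans _ (sf n x))// ler_piMr// cutoff_le1.
- move=> x; rewrite -[X in _ --> X]mulr1; apply: cvgM; last exact: cutoff_cvg1.
  have /fine_cvgP[_] : EFin \o s ^~ x @ \oo --> (f x)%:E.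
    by apply: (cvg_nnsfun_approx measurableT mf) => // y _; rewrite lee_fin.
  exact.
Qed.

Theorem C00_dense f e : H f -> 0 < e -> exists2 g, C00_fun g & lux (f \- g) <= e.
Proof.
move=> Hf e0; suff [_ /(_ _ e0)] : C00_closure f by [].
have [mp mn] : measurable_fun setT (f \max cst 0) /\
    measurable_fun setT ((\- f) \max cst 0).
  split; apply: measurable_maxr => //; first exact: heart_measurable Hf.
  exact: heart_measurable (heartN hphi Hf).
have -> : f = (f \max cst 0) \- ((\- f) \max cst 0).
  by apply/funext => x /=; rewrite /Num.max; case: ifP; case: ifP; lra.
apply: C00_closureB; apply: C00_closure_ge0 => [|x].
- apply: (heart_le hphi Hf mp); apply: aeW => x /=; rewrite /Num.max.
  by case: ifP; rewrite ?normr0 ?normr_ge0.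
- by rewrite /= le_max lexx orbT.
- apply: (heart_le hphi Hf mn); apply: aeW => x /=; rewrite /Num.max.
  by case: ifP; rewrite ?normr0 ?normr_ge0 ?normrN.
- by rewrite /= le_max lexx orbT.
Qed.

End density.

(** * Completeness of the Orlicz heart *)

Section limn_einf_lemmas.
Context {R : realType}.
Implicit Types (u : nat -> \bar R) (a c : \bar R).
Local Open Scope ereal_scope.

Lemma limn_einf_ge u a : (\forall n \near \oo, a <= u n) -> a <= limn_einf u.
Proof.
move=> [N _ au]; rewrite limn_einf_lim; apply: lime_ge; first exact: is_cvg_einfs.
exists N => // n /= Nn; apply: le_ereal_inf_tmp => _ [k /= nk <-].
by apply: au => /=; exact: leq_trans nk.
Qed.

Lemma limn_einf_le u c : (forall n, u n <= c) -> limn_einf u <= c.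
Proof.
move=> uc; rewrite limn_einf_lim; apply: lime_le; first exact: is_cvg_einfs.
by apply: nearW => n; apply: le_trans (uc n); apply: ereal_inf_lbound; exists n => /=.
Qed.

Lemma measurable_limn_einf disp (T : measurableType disp) (f : nat -> T -> \bar R) :
  (forall n, measurable_fun setT (f n)) ->
  measurable_fun setT (fun x => limn_einf (f ^~ x)).
Proof.
move=> mf; apply: measurableT_comp => //.
by apply: (@measurable_fun_limn_esup _ _ _ _ (fun n x => - f n x)) => n; exact: measurableT_comp.
Qed.

End limn_einf_lemmas.

Section riesz_fischer.
Context {R : realType} {d : nat} {phi : R -> R} (hphi : young_generator phi).
Implicit Types (f g h u : 'rV[R]_d -> R).
Local Notation mu := (lebesgue_rV R d).
Local Notation M := (@modular R d phi).
Local Notation H := (@orlicz_heart R d phi).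
Local Notation lux := (@luxemburg R d phi 1).

(** Fatou for the modular. Enlarging the parameter from [m] to [m'] replaces
the continuity of [young phi]: where [u x != 0], eventually
[`|u x| / m' <= `|v n x| / m]. *)
Lemma modular_fatou (v : nat -> 'rV[R]_d -> R) u c m m' : 0 < m -> m < m' ->
  (forall n, measurable_fun setT (v n)) -> measurable_fun setT u ->
  {ae mu, forall x, v n x @[n --> \oo] --> u x} ->
  (forall n, M (v n) m <= c)%E -> (M u m' <= c)%E.
Proof.
move=> m0 mm' mv mfu vu vc; have m'0 := lt_trans m0 mm'.
have mV n : measurable_fun setT (fun x => (young phi (v n x / m))%:E).
  exact: measurable_modular_integrand.
apply: (@le_trans _ _ (\int[mu]_x limn_einf (fun n => (young phi (v n x / m))%:E))%E).
  apply: ae_ge0_le_integral => //.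
  - by move=> x _; rewrite lee_fin young_nonneg.
  - exact: measurable_modular_integrand.
  - move=> x _; apply: limn_einf_ge; apply: nearW => n.
    by rewrite lee_fin young_nonneg.
  - exact: measurable_limn_einf.
  apply: filterS vu => x vux _; apply: limn_einf_ge.
  have [->|ux] := eqVneq (u x) 0.
    by apply: nearW => n; rewrite mul0r young0 lee_fin young_nonneg.
  have vux' : `|v n x| @[n --> \oo] --> `|u x| by exact: cvg_norm.
  have mu1 : `|u x| * (m / m') < `|u x|.
    by rewrite -[ltRHS]mulr1 ltr_pM2l ?normr_gt0// ltr_pdivrMr// mul1r.
  have : \forall n \near \oo, `|u x| * (m / m') < `|v n x|.
    exact: cvgr_gt vux' _ mu1.
  apply: filterS => n vn; rewrite lee_fin le_young// !normrM !normfV.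
  rewrite !(gtr0_norm m0) !(gtr0_norm m'0) ler_pdivlMr// -mulrA.
  by rewrite ltW// (mulrC m'^-1).
apply: le_trans (fatou mu measurableT mV _) _.
  by move=> n x _; rewrite lee_fin young_nonneg.
exact: limn_einf_le.
Qed.

Lemma telescope_sum_cvg (w : nat -> R) (K : R) :
  (forall N, \sum_(0 <= k < N) `|w k.+1 - w k| <= K) -> cvgn w.
Proof.
move=> wK.
have : cvgn [normed series (telescope w)].
  apply: nondecreasing_is_cvgn.
    apply: nondecreasing_series => k _ _; exact: normr_ge0.
  by exists K => _ [N _ <-]; exact: wK.
move=> /normed_cvg cw.
rewrite (_ : w = cst (w 0%N) \+ series (telescope w)).
  exact: is_cvgD (is_cvg_cst _) cw.
by apply/funext => n; exact: eq_sum_telescope.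
Qed.

(** The partial sums [G N] of the increments have modular at most [1], so by Fatou
[young phi (G N x)] has a finite lower limit for almost every [x]. As [young phi] is
coercive, the sums are bounded and [u_ n x] converges. Fatou once more bounds the
distance of the limit to [u_ n]. *)
Lemma heart_complete (u_ : nat -> 'rV[R]_d -> R) :
  (forall n, H (u_ n)) ->
  (forall n, lux (u_ n.+1 \- u_ n) <= 2^-1 ^+ n.+1) ->
  exists2 u, H u & forall n, lux (u \- u_ n) <= 2^-1 ^+ n.
Proof.
move=> Hu du.
have p0 n : 0 < 2^-1 ^+ n :> R by rewrite exprn_gt0// invr_gt0.
pose G N := fun x => \sum_(0 <= k < N) `|u_ k.+1 x - u_ k x|.
have GS N : G N.+1 = G N \+ (fun x => `|(u_ N.+1 \- u_ N) x|).
  by apply/funext => x; rewrite /G big_nat_recr.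
have HG N : H (G N) /\ lux (G N) <= 1 - 2^-1 ^+ N.
  elim: N => [|N [HGN lGN]].
    rewrite (_ : G 0%N = cst 0); last by apply/funext => x; rewrite /G big_nil.
    by split; [exact: heart0|rewrite luxemburg0// expr0 subrr].
  have HD := heartB hphi (Hu N.+1) (Hu N); have HnD := heart_norm hphi HD.
  have HS := heartD hphi HGN HnD.
  rewrite GS; split=> //; apply: (@le_trans _ _ (lux (G N) + lux (u_ N.+1 \- u_ N))).
    apply: luxemburg_le_add => //; first exact: heart_measurable HS.
    by apply: aeW => x /=; rewrite (le_trans (ler_normD _ _))// normr_id.
  apply: le_trans (lerD lGN (du N)) _.
  by rewrite exprS; lra.
have MG N : (M (G N) 1 <= 1%:E)%E.
  have [HGN lGN] := HG N; apply/(luxemburg_leP hphi _ HGN) => //.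
  by rewrite (le_trans lGN)// gerBl ltW.
have mG N : measurable_fun setT (fun x => (young phi (G N x / 1))%:E).
  by apply: measurable_modular_integrand => //; have [[]] := HG N.
have aecvg : {ae mu, forall x, cvgn (u_ ^~ x)}.
  have /(integrable_ae measurableT) : mu.-integrable setT
      (fun x => limn_einf (fun N => (young phi (G N x / 1))%:E)).
    apply/integrableP; split; first exact: measurable_limn_einf.
    under eq_integral.
      move=> x _; rewrite gee0_abs; last first.
        by apply: limn_einf_ge; apply: nearW => N; rewrite lee_fin young_nonneg.
      over.
    apply: le_lt_trans (fatou mu measurableT mG _) _.
      by move=> n x _; rewrite lee_fin young_nonneg.
    by apply: (@le_lt_trans _ _ 1%:E); [exact: limn_einf_le|exact: ltry].
  apply: filterS => x /(_ I) Lfin.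
  have [K K0 LK] := young_coercive hphi
    (fine (limn_einf (fun N => (young phi (G N x / 1))%:E))).
  apply: (@telescope_sum_cvg _ K) => N; apply: le_trans (ler_norm _) _.
  apply: LK; rewrite -lee_fin fineK//; apply: limn_einf_ge; exists N => // k /= Nk.
  rewrite lee_fin le_young// divr1 !ger0_norm ?sumr_ge0//.
  by rewrite /G [leRHS](@big_cat_nat _ _ _ N)//= lerDl sumr_ge0.
(* The upper limit is measurable, and is the limit wherever that exists. *)
pose u := fun x => fine (limn_esup (fun n => (u_ n x)%:E)).
have mU : measurable_fun setT u.
  apply: measurableT_comp; first exact: fine_measurable.
  apply: measurable_fun_limn_esup => n; apply/measurable_EFinP.
  exact: heart_measurable (Hu n).
have aeu : {ae mu, forall x, u_ n x @[n --> \oo] --> u x}.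
  apply: filterS aecvg => x /cvg_ex[l ul]; rewrite /u.
  have ul' : (u_ n x)%:E @[n --> \oo] --> l%:E by apply: cvg_EFin => //; exact: nearW.
  by rewrite (cvg_limn_einf_sup ul').2.
have lun n N : lux (u_ (n + N)%N \- u_ n) <= 2^-1 ^+ n - 2^-1 ^+ (n + N).
  elim: N => [|N IHN].
    rewrite addn0 (_ : _ \- _ = cst 0) ?luxemburg0 ?subrr//.
    by apply/funext => x /=; rewrite subrr.
  rewrite addnS.
  apply: le_trans (luxemburg_triangle hphi _ (Hu _) (Hu (n + N)%N) (Hu _)) _ => //.
  apply: le_trans (lerD (du _) IHN) _.
  by rewrite exprS; lra.
have Mun n m : 2^-1 ^+ n < m -> (M (u \- u_ n)%R m <= 1%:E)%E.
  move=> nm; apply: (@modular_fatou (fun N => u_ (n + N)%N \- u_ n) _ _ (2^-1 ^+ n)) => //.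
  - by move=> N; apply: measurable_funB; exact: heart_measurable (Hu _).
  - by apply: measurable_funB => //; exact: heart_measurable (Hu _).
  - apply: filterS aeu => x ux /=; apply: cvgB; last exact: cvg_cst.
    move: ux; rewrite -(cvg_shiftn n (fun k => u_ k x)) => ux.
    by under eq_fun do rewrite addnC.
  move=> N; apply/(luxemburg_leP hphi _ (heartB hphi (Hu _) (Hu _))) => //.
  by rewrite (le_trans (lun n N))// gerBl ltW.
exists u; last by move=> n; apply: luxemburg_le_gt => [|m /Mun//]; exact: ltW.
apply: modular_ltoo => // e e0; exists e; first by rewrite e0 lexx.
have e20 : 0 < e / 2 by rewrite divr_gt0.
have [N _ /(_ N (leqnn N)) pN] : \forall n \near \oo, `|2^-1 ^+ n| < e / 2 :> R.
  by apply: cvgr0_norm_lt => //; apply: cvg_expr; rewrite ger0_norm; lra.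
rewrite gtr0_norm// in pN.
have [c c0 cE] := heart_modular hphi (Hu N) e20.
apply: (@le_lt_trans _ _
  ((1 / 2)%:E * M (u_ N) (e / 2) + (1 - 1 / 2)%:E * M (u \- u_ N)%R (e / 2))%E).
  apply: modular_conv => //; first by lra.
  - exact: heart_measurable (Hu N).
  - by apply: measurable_funB => //; exact: heart_measurable (Hu _).
  apply: aeW => x; rewrite !normrM.
  have -> : `|(e / 2)^-1| = 2 * `|e^-1| by rewrite !gtr0_norm ?invr_gt0// invf_div mulrC.
  have : `|u x| <= `|u_ N x| + `|(u \- u_ N) x|.
    by rewrite -{1}(subrK (u_ N x) (u x)) addrC ler_normD.
  by move=> /(ler_wpM2r (normr_ge0 e^-1)); lra.
rewrite cE -EFinM lte_add_pinfty ?ltry//.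
apply: (@le_lt_trans _ _ ((1 - 1 / 2)%:E * 1%:E)%E); last by rewrite -EFinM ltry.
by apply: lee_wpmul2l; [rewrite lee_fin; lra|exact: Mun].
Qed.

End riesz_fischer.

(** * Lipschitz estimates for convex operators *)

Section convex_lipschitz.
Context {R : realType} {d : nat} {phi : R -> R} (hphi : young_generator phi).
Implicit Types (f g h u v : 'rV[R]_d -> R) (rho t : R).
Local Notation M := (@modular R d phi).
Local Notation H := (@orlicz_heart R d phi).
Local Notation lux := (@luxemburg R d phi).

Lemma heart_absD u v : H u -> H v -> H (fun x => `|u x| + `|v x|).
Proof. by move=> Hu Hv; apply: heartD => //; exact: heart_norm. Qed.

Lemma luxemburg_absD rho u v : 1 <= rho -> H u -> H v ->
  lux rho (fun x => `|u x| + `|v x|) <= lux rho u + lux rho v.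
Proof.
move=> rho1 Hu Hv; apply: luxemburg_le_add => //.
  exact: heart_measurable (heart_absD Hu Hv).
by apply: aeW => x; rewrite ger0_norm ?addr_ge0.
Qed.

Lemma orlicz_ball0 rho r f : orlicz_ball phi rho (cst 0) r f <-> H f /\ lux rho f <= r.
Proof.
rewrite /orlicz_ball /= (_ : f \- cst 0 = f)//.
by apply/funext => x /=; rewrite subr0.
Qed.

Context (a : R) (a0 : 0 <= a) (E : set ('rV[R]_d -> R))
  (S : R -> ('rV[R]_d -> R) -> 'rV[R]_d -> R).
Hypothesis E_comb : forall c e f g, E f -> E g -> E (fun x => c * f x + e * g x).
Hypothesis S_heart : forall t f, 0 <= t -> E f -> H f -> H (S t f).
Hypothesis S_convex : forall t s f g, 0 <= t -> E f -> H f -> E g -> H g -> 0 <= s <= 1 ->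
  ae_le (S t (fun x => s * f x + (1 - s) * g x))
        (fun x => s * S t f x + (1 - s) * S t g x).
Hypothesis S_norm : norm_estimate phi a E S.

Lemma convex_gap (s y z p : R) : 0 <= s -> y <= s * p + (1 - s) * z ->
  y - z <= s * (`|p| + `|z|).
Proof.
move=> s0 yz; apply: (@le_trans _ _ (s * (p - z))).
  by rewrite lerBlDr (le_trans yz)// mulrBl mul1r mulrBr addrCA addrC.
by rewrite ler_wpM2l// (le_trans (ler_norm _))// ler_normB.
Qed.

(** With [p = g + (f - g) / s], the function [f] is the convex combination
[s p + (1 - s) g], so that [S f - S g <= s (S p - S g)]; as long as [s] is not
below [(3 / 2) e^{at} |f - g|], the point [p] stays in the ball on which
[S t] is bounded by [1]. *)
Lemma convex_difference_bound rho t f g s : 0 <= t -> 1 <= rho ->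
  E f -> H f -> E g -> H g ->
  lux rho f <= expR (- (a * t)) / 3 -> lux rho g <= expR (- (a * t)) / 3 ->
  0 < s <= 1 -> 3 / 2 * expR (a * t) * lux rho (f \- g) <= s ->
  lux rho (S t f \- S t g) <= 8 / 3 * s.
Proof.
move=> t0 rho1 Ef Hf Eg Hg; set k := expR (- (a * t)); set K := expR (a * t).
move=> fk gk /andP[s0 s1].
have k0 : 0 < k by exact: expR_gt0.
have K0 : 0 < K by exact: expR_gt0.
have Kk : K * k = 1 by rewrite /K /k expRN mulfV// gt_eqF// expR_gt0.
have shift u v : E u -> H u -> E v -> H v -> lux rho u <= k / 3 ->
    3 / 2 * K * lux rho (v \- u) <= s ->
  let p := fun x => s^-1 * v x + (1 - s^-1) * u x in
  [/\ E p, H p, lux rho (S t p) <= 1 &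
    ae_le (S t v) (fun x => s * S t p x + (1 - s) * S t u x)].
  move=> Eu Hu Ev Hv uk uvs p.
  have Ep : E p by exact: E_comb.
  have Hp : H p by apply: heartD => //; exact: heartZ.
  have Hvu := heartB hphi Hv Hu.
  have pk : lux rho p <= k.
    apply: (@le_trans _ _ (lux rho u + lux rho (fun x => s^-1 * (v \- u) x))).
      apply: luxemburg_le_add => //; [exact: heartZ|exact: heart_measurable Hp|].
      apply: aeW => x; rewrite /p (_ : _ + _ = u x + s^-1 * (v \- u) x).
        exact: ler_normD.
      by rewrite /=; ring.
    rewrite luxemburgZ// gtr0_norm ?invr_gt0//.
    rewrite (_ : k = k / 3 + 2 / 3 * k); last by field.
    apply: (lerD uk); rewrite ler_pdivrMl// (_ : s * _ = s / (3 / 2 * K)).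
      by rewrite ler_pdivlMr ?mulr_gt0// mulrC.
    by rewrite -[k](mulKf (lt0r_neq0 K0)) Kk; field; rewrite gt_eqF.
  split=> //.
    apply: le_trans (S_norm t0 rho1 (conj Ep (_ : orlicz_ball _ _ _ _ p))) _.
      exact/orlicz_ball0.
    by rewrite -Kk ler_pM2l.
  have := S_convex t0 Ep Hp Eu Hu (_ : 0 <= s <= 1); rewrite (ltW s0) s1 => /(_ isT).
  rewrite (_ : (fun x => s * p x + (1 - s) * u x) = v)//.
  by apply/funext => x; rewrite /p; field; rewrite gt_eqF.
move=> fgs.
have [Ep Hp Sp1 fp] := shift g f Eg Hg Ef Hf gk fgs.
have [|Eq Hq Sq1 gq] := shift f g Ef Hf Eg Hg fk; first by rewrite luxemburgBC.
move: Ep Hp Sp1 fp Eq Hq Sq1 gq.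
set p := (fun x => s^-1 * f x + _); set q := (fun x => s^-1 * g x + _).
move=> Ep Hp Sp1 fp Eq Hq Sq1 gq.
have Sk u : E u -> H u -> lux rho u <= k / 3 -> lux rho (S t u) <= 1 / 3.
  move=> Eu Hu uk; apply: le_trans (S_norm t0 rho1 (conj Eu (_ : orlicz_ball _ _ _ _ u))) _.
    apply/orlicz_ball0; split=> //; apply: (le_trans uk).
    by rewrite ler_pdivrMr// ler_peMr ?(ltW k0)// ler1n.
  by have := ler_wpM2l (ltW K0) uk; rewrite mulrA Kk.
have [HSf HSg HSp HSq] : [/\ H (S t f), H (S t g), H (S t p) & H (S t q)].
  by split; apply: S_heart.
pose W := fun x => `| `|S t p x| + `|S t g x| | + `| `|S t q x| + `|S t f x| |.
have [HW1 HW2] := (heart_absD HSp HSg, heart_absD HSq HSf).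
have HW : H W by exact: heart_absD.
have lW : lux rho W <= 8 / 3.
  apply: le_trans (luxemburg_absD rho1 HW1 HW2) _.
  apply: le_trans (lerD (luxemburg_absD rho1 HSp HSg) (luxemburg_absD rho1 HSq HSf)) _.
  rewrite (_ : 8 / 3 = (1 + 1 / 3) + (1 + 1 / 3)); last by field.
  exact: (lerD (lerD Sp1 (Sk _ Eg Hg gk)) (lerD Sq1 (Sk _ Ef Hf fk))).
apply: (@le_trans _ _ (lux rho (fun x => s * W x))); last first.
  by rewrite luxemburgZ// gtr0_norm// mulrC ler_pM2r.
apply: le_luxemburg => //; [exact: heartZ|exact: heart_measurable (heartB hphi HSf HSg)|].
move: fp gq; rewrite /ae_le; apply: filterS2 => x fpx gqx /=.
rewrite (ger0_norm (_ : 0 <= s * W x)); last by rewrite mulr_ge0 ?(ltW s0)// addr_ge0.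
have -> : W x = `|S t p x| + `|S t g x| + (`|S t q x| + `|S t f x|).
  by rewrite /W !(ger0_norm (_ : 0 <= `|_| + `|_|)) ?addr_ge0.
rewrite ler_norml lerNl opprB; apply/andP; split.
  apply: le_trans (convex_gap (ltW s0) gqx) _.
  by rewrite ler_pM2l// lerDr addr_ge0.
apply: le_trans (convex_gap (ltW s0) fpx) _.
by rewrite ler_pM2l// lerDl addr_ge0.
Qed.

Lemma convex_lipschitz_estimate : lipschitz_estimate phi a E S.
Proof.
move=> t rho f g t0 rho1 [Ef /orlicz_ball0[Hf fk]] [Eg /orlicz_ball0[Hg gk]].
have K0 := expR_gt0 (a * t).
have bound := convex_difference_bound t0 rho1 Ef Hf Eg Hg fk gk.
have n0 : 0 <= lux rho (f \- g) := luxemburg_ge0 _ _.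
have Kn1 : 3 / 2 * expR (a * t) * lux rho (f \- g) <= 1.
  have : lux rho (f \- g) <= lux rho f + lux rho g.
    apply: luxemburg_le_add => //; first exact: heart_measurable (heartB hphi Hf Hg).
    by apply: aeW => x; exact: ler_normB.
  move=> /le_trans/(_ (lerD fk gk)) /(ler_wpM2l (ltW K0)).
  by rewrite expRN -mulrDr mulrA mulfV ?gt_eqF//; lra.
have [n00|nn0] := eqVneq (lux rho (f \- g)) 0.
  rewrite n00 mulr0; apply/ler_addgt0Pr => e e0; rewrite add0r.
  have := bound (Num.min 1 (3 / 8 * e)).
  rewrite n00 mulr0 lt_min ge_min lexx ltr01/= mulr_gt0//= => /(_ isT).
  move=> /(_ _)/le_trans; apply; first by rewrite ltW// lt_min ltr01 mulr_gt0.
  apply: (@le_trans _ _ (8 / 3 * (3 / 8 * e))); last by lra.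
  by rewrite ler_pM2l// ge_min lexx orbT.
have n1 : 0 < lux rho (f \- g) by rewrite lt_neqAle eq_sym nn0.
apply: (@le_trans _ _ (8 / 3 * (3 / 2 * expR (a * t) * lux rho (f \- g)))).
  by apply: bound => //; rewrite Kn1 andbT !mulr_gt0.
by rewrite le_eqVlt; apply/orP; left; apply/eqP; field.
Qed.

(** Raising [rho] shrinks the norm of the fixed element [f], which brings a
neighbourhood of [f] into the ball of the previous estimate; the two norms
differ by a factor at most [rho]. *)
Lemma convex_local_lipschitz_estimate : local_lipschitz_estimate phi a E S.
Proof.
move=> f t0 Hf t00; set k := expR (- (a * t0)).
have k0 : 0 < k := expR_gt0 _; have k60 : 0 < k / 6 by rewrite divr_gt0.
have [c c0 cE] := heart_modular hphi Hf k60.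
pose rho := Num.max 1 c; have rho1 : 1 <= rho by rewrite le_max lexx.
exists rho, (k / 6); split=> // t g h /andP[tge0 tt0] [Eg [Hg gf]] [Eh [Hh hf]].
have frho : lux rho f <= k / 6.
  by apply: luxemburg_le => //; rewrite cE lee_fin le_max lexx orbT.
have kt : k <= expR (- (a * t)) by rewrite ler_expR lerN2 ler_wpM2l.
have ball u : E u -> H u -> lux 1 (u \- f) <= k / 6 ->
    (E `&` orlicz_ball phi rho (cst 0) (expR (- (a * t)) / 3)) u.
  move=> Eu Hu uf; split=> //; apply/orlicz_ball0; split=> //.
  have Huf := heartB hphi Hu Hf.
  apply: le_trans (luxemburg_le_dist hphi rho1 Hu Hf) _.
  apply: le_trans (lerD (le_trans (le_luxemburg_rho hphi rho1 Huf) uf) frho) _.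
  by rewrite (_ : k / 6 + k / 6 = k / 3) ?ler_pM2r//; field.
have HD := heartB hphi (S_heart tge0 Eg Hg) (S_heart tge0 Eh Hh).
apply: le_trans (luxemburg_le_rho hphi rho1 HD) _.
rewrite [4 * rho]mulrC -!mulrA ler_pM2l ?(lt_le_trans ltr01 rho1)// !mulrA.
have := convex_lipschitz_estimate tge0 rho1 (ball g Eg Hg gf) (ball h Eh Hh hf).
move=> /le_trans; apply.
rewrite ler_pM2l ?mulr_gt0 ?expR_gt0//.
have := le_luxemburg_rho hphi rho1 (heartB hphi Hg Hh). exact.
Qed.

End convex_lipschitz.

(** * Estimates for the semigroup from its majorant *)

Section majorized_semigroup.
Context {R : realType} {d : nat} {phi : R -> R} (hphi : young_generator phi).
Context {disp : measure_display} {Omega : measurableType disp}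
  {P : probability Omega R} {X : R -> Omega -> 'rV[R]_d} {a : R}
  {S : R -> ('rV[R]_d -> R) -> ('rV[R]_d -> R)}.
Hypothesis mX : forall t : R, 0 <= t -> measurable_fun setT (X t).
Hypothesis hS : C0_semigroup S.
Hypothesis hST : forall (t : R) f, 0 <= t -> (C0_fun `&` orlicz_heart phi) f ->
  ae_le (fun x => `|S t f x|) (levy_majorant P X phi a t (fun x => `|f x|)).
Implicit Types (f g h u v : 'rV[R]_d -> R) (rho t m : R).
Local Notation mu := (lebesgue_rV R d).
Local Notation M := (@modular R d phi).
Local Notation H := (@orlicz_heart R d phi).
Local Notation lux := (@luxemburg R d phi).

Definition levy_modular t f m (x : 'rV[R]_d) : \bar R :=
  (\int[P]_w (young phi (expR (a * t) * f (x + X t w) / m))%:E)%E.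

Lemma measurable_levy_integrand t f m : 0 <= t -> measurable_fun setT f ->
  measurable_fun setT
    (fun z : 'rV[R]_d * Omega => (young phi (expR (a * t) * f (z.1 + X t z.2) / m))%:E).
Proof.
move=> t0 mf; apply/measurable_EFinP; apply: measurableT_comp (measurable_young hphi) _.
do 2 apply: measurable_funM => //.
by apply: measurableT_comp mf _; apply: measurable_add_rV; exact: mX.
Qed.

Lemma levy_modular_ge0 t f m x : (0 <= levy_modular t f m x)%E.
Proof. by apply: integral_ge0 => w _; rewrite lee_fin young_nonneg. Qed.

Lemma measurable_levy_modular t f m : 0 <= t -> measurable_fun setT f ->
  measurable_fun setT (levy_modular t f m).
Proof.
move=> t0 mf.
have := measurable_levy_integrand m t0 mf.
move=> /(measurable_fun_fubini_tonelli_F (m2 := P)); apply.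
by move=> z; rewrite lee_fin young_nonneg.
Qed.

(** Apply [phi] to both sides of the majorization and subtract [phi 0], which is also
its expectation. *)
Lemma young_majorant_le t f : 0 <= t -> C0_fun f -> H f ->
  {ae mu, forall x, ((young phi (S t f x))%:E <= levy_modular t f 1 x)%E}.
Proof.
move=> t0 Cf Hf; have := hST t0 (conj Cf Hf); apply: filterS => x.
rewrite /levy_majorant unlock.
have mw : measurable_fun setT
    (fun w => (young phi (expR (a * t) * f (x + X t w) / 1))%:E).
  have := measurable_levy_integrand 1 t0 (heart_measurable Hf).
  move=> mz; have mp : measurable_fun setT (fun w : Omega => (x, w)).
    exact: measurable_fun_pair.
  by have := measurableT_comp mz mp.
have -> : (\int[P]_w (phi (expR (a * t) * `|f (x + X t w)|))%:E)%E =
    (levy_modular t f 1 x + (phi 0)%:E)%E.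
  rewrite (_ : (phi 0)%:E = \int[P]_w (phi 0)%:E)%E; last first.
    by rewrite integral_cst// [X in (_ * X)%E]probability_setT mule1.
  rewrite /levy_modular -ge0_integralD//; last 2 first.
  - by move=> w _; rewrite lee_fin young_nonneg.
  - by move=> w _; rewrite lee_fin (young_ge0 hphi).
  apply: eq_integral => w _; rewrite -EFinD /young divr1 subrK normrM.
  by rewrite (ger0_norm (expR_ge0 _)).
have := levy_modular_ge0 t f 1 x.
case: (levy_modular t f 1 x) => [c| |]//; last by move=> _ _; rewrite leey.
rewrite lee_fin => c0; rewrite -EFinD /= => /(young_phi_inv hphi (normr_ge0 _)).
by rewrite lee_fin /young lerBlDr; apply; rewrite lerDr.
Qed.

Lemma semigroup0 t : 0 <= t -> {ae mu, forall x, S t (cst 0) x = 0}.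
Proof.
move=> t0; have := young_majorant_le t0 C0_fun0 heart0.
apply: filterS => x; rewrite /levy_modular.
under eq_integral do rewrite mulr0 mul0r young0.
rewrite integral0 lee_fin => Sx; apply/eqP/negPn/negP => /(young_gt0 hphi).
by rewrite ltNge Sx.
Qed.

(** Since [S t 0 = 0], convexity gives [S t f / m <= S t (f / m)] and
[- S t f / m <= S t (- f / m)] for [m <= 1], so that the majorant of
[f / m] controls [`|S t f| / m]. *)
Lemma young_semigroup_le t f m : 0 <= t -> 0 < m <= 1 -> C0_fun f -> H f ->
  {ae mu, forall x, ((young phi (S t f x / m))%:E <= levy_modular t f m x)%E}.
Proof.
move=> t0 /andP[m0 m1] Cf Hf.
pose F := fun x => m^-1 * f x; pose G := fun x => - m^-1 * f x.
have [CF CG] : C0_fun F /\ C0_fun G by split; exact: C0_funZ.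
have [HF HG] : H F /\ H G by split; exact: heartZ.
have C0 := @C0_fun0 R d.
have m01 : 0 <= m <= 1 by rewrite ltW.
have half01 : 0 <= (1 / 2 : R) <= 1 by lra.
have cvx (s : R) u v x : C0_fun u -> C0_fun v -> 0 <= s <= 1 ->
    S t (fun y => s * u y + (1 - s) * v y) x <= s * S t u x + (1 - s) * S t v x.
  by move=> Cu Cv s01; exact: (semigroup_convex hS t0 Cu Cv s01).
have := young_majorant_le t0 CF HF; have := young_majorant_le t0 CG HG.
have := semigroup0 t0; apply: filterS3 => x Sx0 SG SF.
have cvx0 u : C0_fun u -> S t (fun y => m * u y) x <= m * S t u x.
  move=> Cu; have := cvx m u (cst 0) x Cu C0 m01.
  have -> : (fun y => m * u y + (1 - m) * cst 0 y) = (fun y => m * u y).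
    by apply/funext => y; rewrite /= mulr0 addr0.
  by rewrite Sx0 [X in _ + X]mulr0 addr0.
have mF : S t f x <= m * S t F x.
  have := cvx0 F CF; rewrite (_ : (fun y => m * F y) = f)//.
  by apply/funext => y; rewrite /F mulVKf// gt_eqF.
have mG : S t (fun y => -1 * f y) x <= m * S t G x.
  have := cvx0 G CG; rewrite (_ : (fun y => m * G y) = (fun y => -1 * f y))//.
  by apply/funext => y; rewrite /G; field; rewrite gt_eqF.
have sum0 : 0 <= S t f x + S t (fun y => -1 * f y) x.
  have := cvx (1 / 2) f (fun y => -1 * f y) x Cf (C0_funZ _ Cf) half01.
  rewrite (_ : (fun y => 1 / 2 * f y + _) = cst 0) ?Sx0; last first.
    by apply/funext => y /=; field.
  lra.
have EF w : (young phi (expR (a * t) * F (x + X t w) / 1))%:E =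
    (young phi (expR (a * t) * f (x + X t w) / m))%:E.
  by rewrite divr1 /F; congr ((young phi _)%:E); ring.
have EG w : (young phi (expR (a * t) * G (x + X t w) / 1))%:E =
    (young phi (expR (a * t) * f (x + X t w) / m))%:E.
  rewrite divr1 /G -young_norm -[in RHS]young_norm -normrN.
  by congr ((young phi `|_|)%:E); ring.
move: SG SF; rewrite /levy_modular; under eq_integral do rewrite EG.
under [X in _ -> (_ <= X)%E -> _]eq_integral do rewrite EF.
move=> SG SF; have [Sf0|Sf0] := leP 0 (S t f x).
  apply: le_trans SF; rewrite lee_fin le_young// normrM normfV (gtr0_norm m0).
  rewrite ler_pdivrMr// ger0_norm//; apply: (le_trans mF).
  by rewrite mulrC ler_pM2r// ler_norm.
apply: le_trans SG; rewrite lee_fin le_young// normrM normfV (gtr0_norm m0).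
rewrite ler_pdivrMr// ltr0_norm//; apply: (@le_trans _ _ (m * S t G x)); first by lra.
by rewrite mulrC ler_pM2r// ler_norm.
Qed.

Lemma C0_semigroup_measurable t f : 0 <= t -> C0_fun f -> measurable_fun setT (S t f).
Proof. by move=> t0 Cf; apply: C0_fun_measurable; exact: (semigroup_stable hS). Qed.

Lemma levy_modular_integral t f m : 0 <= t -> measurable_fun setT f ->
  (\int[mu]_x (young phi (expR (a * t) * f x / m))%:E = M f (m * expR (- (a * t))))%E.
Proof.
move=> t0 mf; apply: eq_integral => x _; congr ((young phi _)%:E).
by rewrite expRN invfM invrK mulrA (mulrC (expR _)) mulrAC.
Qed.

(** Integrating the pointwise bound over [x] removes the random shift. *)
Lemma modular_semigroup_le t f m : 0 <= t -> 0 < m <= 1 -> C0_fun f -> H f ->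
  (M (S t f) m <= M f (m * expR (- (a * t))))%E.
Proof.
move=> t0 m01 Cf Hf; have mf := heart_measurable Hf.
apply: (@le_trans _ _ (\int[mu]_x levy_modular t f m x)%E).
  apply: ae_ge0_le_integral => //.
  - by move=> x _; rewrite lee_fin young_nonneg.
  - by apply: measurable_modular_integrand => //; exact: C0_semigroup_measurable.
  - by move=> x _; exact: levy_modular_ge0.
  - exact: measurable_levy_modular.
  by have := young_semigroup_le t0 m01 Cf Hf; apply: filterS.
have := @integral_shift_rv R _ _ P d (X t) setT
  (fun x => (young phi (expR (a * t) * f x / m))%:E) (mX t0) measurableT.
rewrite probability_setT mul1e levy_modular_integral// => <-.
- by under [X in (_ <= X)%E]eq_integral do under eq_integral do rewrite indicT mule1.
- by apply: measurable_modular_integrand => //; exact: measurable_funM.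
- by move=> x; rewrite lee_fin young_nonneg.
Qed.

(** At a distance at least [r] from the support of [f], the majorant only sees the
event that [X t] has moved by at least [r]. *)
Lemma modular_semigroup_tail t f m r0 r : 0 <= t -> 0 < m <= 1 -> C0_fun f -> H f ->
  (forall x, r0 <= `|x| -> f x = 0) ->
  (\int[mu]_(x in ~` cball (r0 + r)) (young phi (S t f x / m))%:E
   <= P [set w | (r <= enorm (X t w))%R] * M f (m * expR (- (a * t))))%E.
Proof.
move=> t0 m01 Cf Hf f0; have mf := heart_measurable Hf.
set B := [set w | r <= enorm (X t w)].
have mB : measurable B.
  rewrite -[B]setTI (_ : B = (fun w => enorm (X t w)) @^-1` `[r, +oo[); last first.
    by apply/seteqP; split=> w /=; rewrite in_itv/= andbT.
  have mE : measurable_fun setT (@enorm R d).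
    apply: measurableT_comp.
      by apply: continuous_measurable_fun; exact: sqrt_continuous.
    by apply: measurable_sum => i; apply: measurable_funX; exact: measurable_coord_rV.
  by apply: (measurableT_comp mE (mX t0)).
have mD : measurable (~` @cball R d (r0 + r)).
  by apply: measurableC; exact: measurable_cball.
have mlev := @measurable_levy_integrand t f m t0 mf.
have mlevB : measurable_fun setT (fun z : 'rV[R]_d * Omega =>
    (young phi (expR (a * t) * f (z.1 + X t z.2) / m))%:E * (\1_B z.2)%:E)%E.
  apply: emeasurable_funM => //; apply/measurable_EFinP.
  by apply: measurableT_comp.
have lev0 (z : 'rV[R]_d * Omega) :
    (0 <= (young phi (expR (a * t) * f (z.1 + X t z.2) / m))%:E * (\1_B z.2)%:E)%E.
  by rewrite mule_ge0// lee_fin ?young_nonneg.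
have mJ := measurable_fun_fubini_tonelli_F (m2 := P) _ mlevB lev0.
apply: (@le_trans _ _ (\int[mu]_(x in ~` cball (r0 + r))
    \int[P]_w ((young phi (expR (a * t) * f (x + X t w) / m))%:E * (\1_B w)%:E))%E).
  apply: ae_ge0_le_integral => //.
  - by move=> x _; rewrite lee_fin young_nonneg.
  - apply: measurable_funTS; apply: measurable_modular_integrand => //.
    exact: C0_semigroup_measurable.
  - by move=> x _; apply: integral_ge0 => w _; exact: (lev0 (x, w)).
  - exact: measurable_funTS.
  have := young_semigroup_le t0 m01 Cf Hf; apply: filterS => x Sx /= xr.
  apply: (le_trans Sx); rewrite le_eqVlt; apply/orP; left; apply/eqP.
  apply: eq_integral => w _; rewrite indicE.
  have [wB|wB] := boolP (w \in B); first by rewrite mule1.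
  rewrite f0 ?mulr0 ?mul0r ?young0 ?mul0e//.
  move: wB; rewrite notin_setE/= => /negP; rewrite -ltNge => wr.
  move: xr => /negP; rewrite -ltNge => xr.
  have := norm_le_enorm (X t w); have := ler_normB (x + X t w) (X t w).
  by rewrite addrK; lra.
rewrite -levy_modular_integral//.
rewrite -(@integral_shift_rv R _ _ P d (X t) B _ (mX t0) mB); last 2 first.
- by apply: measurable_modular_integrand => //; exact: measurable_funM.
- by move=> x; rewrite lee_fin young_nonneg.
apply: ge0_subset_integral => //.
by move=> x _; apply: integral_ge0 => w _; exact: (lev0 (x, w)).
Qed.

Lemma heart_semigroup t f : 0 <= t -> C0_fun f -> H f -> H (S t f).
Proof.
move=> t0 Cf Hf; apply: modular_ltoo => //; first exact: C0_semigroup_measurable.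
move=> e e0; have m0 : 0 < Num.min e 1 by rewrite lt_min e0 ltr01.
exists (Num.min e 1); first by rewrite m0 ge_min lexx.
apply: le_lt_trans (modular_semigroup_le t0 _ Cf Hf) _.
  by rewrite m0 ge_min lexx orbT.
by apply: Hf.2; rewrite mulr_gt0// expR_gt0.
Qed.

(** The modular inequality holds at scales up to [1]; for [f] in the ball of radius
[e^{-at}] the larger scales reduce to the scale [1]. *)
Lemma C0_norm_estimate : norm_estimate phi a C0_fun S.
Proof.
move=> t rho f t0 rho1 [Cf /orlicz_ball0[Hf fk]].
have [K0 k0] := (expR_gt0 (a * t), expR_gt0 (- (a * t))).
apply: luxemburg_le_gt => [|m]; first by rewrite mulr_ge0 ?luxemburg_ge0// ltW.
move=> Kfm; have m0 : 0 < m.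
  by apply: le_lt_trans Kfm; rewrite mulr_ge0 ?luxemburg_ge0// ltW.
have mS := C0_semigroup_measurable t0 Cf.
have [m1|m1] := leP m 1.
  apply: le_trans (modular_semigroup_le t0 _ Cf Hf) _; first by rewrite m0.
  apply: luxemburg_lt_modular => //.
  by rewrite expRN ltr_pdivlMr// mulrC.
apply: (@le_trans _ _ (M (S t f) 1)).
  apply: le_modular => //; apply: aeW => x; rewrite divr1 normrM normfV (gtr0_norm m0).
  by rewrite ler_pdivrMr// ler_peMr// ltW.
apply: le_trans (modular_semigroup_le t0 _ Cf Hf) _; first by rewrite ltr01 lexx.
by rewrite mul1r; apply/luxemburg_leP.
Qed.

End majorized_semigroup.

(** * Behaviour for small times *)

Section small_time.
Context {R : realType} {d : nat} {phi : R -> R} (hphi : young_generator phi).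
Implicit Types (f g h u v : 'rV[R]_d -> R) (rho t m r c : R).
Local Notation mu := (lebesgue_rV R d).
Local Notation M := (@modular R d phi).
Local Notation H := (@orlicz_heart R d phi).
Local Notation lux := (@luxemburg R d phi 1).

Lemma young_le_linear (z : R) : 0 <= z <= 1 -> young phi z <= z * young phi 1.
Proof. by move=> z01; rewrite -{1}[z]mulr1; exact: young_scale. Qed.

(** Uniform convergence controls the modular on a ball; only the tails need an
estimate of their own. *)
Lemma luxemburg_small_time (u : R -> 'rV[R]_d -> R) :
  (\forall t \near 0^'+, measurable_fun setT (u t)) ->
  (\forall t \near 0^'+, exists2 K, 0 <= K & forall x, `|u t x| <= K) ->
  sup_norm (u t) @[t --> 0^'+] --> 0 ->
  (forall m, 0 < m <= 1 -> exists r, exists2 b : R -> \bar R,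
     b t @[t --> 0^'+] --> 0%E &
     \forall t \near 0^'+,
       (\int[mu]_(x in ~` cball r) (young phi (u t x / m))%:E <= b t)%E) ->
  lux (u t) @[t --> 0^'+] --> 0.
Proof.
move=> mu_ bu su tail; apply/cvgr0Pnorm_le => e e0.
pose m := Num.min e 1; have m0 : 0 < m by rewrite lt_min e0 ltr01.
have m1 : m <= 1 by rewrite ge_min lexx orbT.
have [|r [b b0 ub]] := tail m; first by rewrite m0.
have lfin := @lebesgue_cball R d r.
pose l := fine (mu (cball r)).
have lE : mu (cball r) = l%:E by rewrite fineK// ge0_fin_numE.
have l0 : 0 <= l by rewrite fine_ge0.
have L0 : 0 < 2 * (young phi 1 * l + 1).
  by rewrite mulr_gt0// ltr_wpDl// mulr_ge0// young_nonneg.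
pose s := m / (2 * (young phi 1 * l + 1)).
have s0 : 0 < s by rewrite divr_gt0.
have sm : s / m <= 1.
  rewrite /s mulrAC mulfV ?gt_eqF// mul1r invf_le1//.
  have : 0 <= young phi 1 * l by rewrite mulr_ge0// young_nonneg.
  lra.
have b_half : \forall t \near 0^'+, (b t < (1 / 2)%:E)%E.
  apply: (b0 [set y : \bar R | (y < (1 / 2)%:E)%E]); apply: open_nbhs_nbhs.
  by split; [exact: open_ereal_lt_ereal|rewrite /= lte_fin].
near=> t.
rewrite ger0_norm ?luxemburg_ge0//.
apply: (@le_trans _ _ m); last by rewrite ge_min lexx.
apply: luxemburg_le => //.
have mut : measurable_fun setT (u t) by near: t.
have But : exists2 K, 0 <= K & forall x, `|u t x| <= K by near: t.
have sut : sup_norm (u t) <= s.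
  by apply: le_trans (ler_norm _) _; near: t; exact: cvgr0_norm_le.
apply: (@le_trans _ _ ((young phi (s / m))%:E * mu (cball r) + (1 / 2)%:E)%E).
  apply: modular_split_le => // [x _|].
    by apply: le_trans sut; exact: le_sup_norm.
  apply: (@le_trans _ _ (b t)); first by near: t.
  by apply: ltW; near: t.
rewrite lE -EFinM -EFinD lee_fin.
have sm0 : 0 <= s / m by rewrite divr_ge0// ltW.
have : young phi (s / m) * l <= s / m * young phi 1 * l.
  by rewrite ler_wpM2r// young_le_linear// sm0.
have : s / m * young phi 1 * l <= 1 / 2; last by lra.
have -> : s / m = (2 * (young phi 1 * l + 1))^-1.
  by rewrite /s mulrAC mulfV ?gt_eqF// mul1r.
rewrite -mulrA ler_pdivrMl//; lra.
Unshelve. all: by end_near. Qed.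

Context {disp : measure_display} {Omega : measurableType disp}
  {P : probability Omega R} {X : R -> Omega -> 'rV[R]_d} {a : R}
  {S : R -> ('rV[R]_d -> R) -> ('rV[R]_d -> R)}.
Hypothesis a0 : 0 <= a.
Hypothesis mX : forall t : R, 0 <= t -> measurable_fun setT (X t).
Hypothesis hXb : small_time_tails P X phi.
Hypothesis hS : C0_semigroup S.
Hypothesis hST : forall (t : R) f, 0 <= t -> (C0_fun `&` orlicz_heart phi) f ->
  ae_le (fun x => `|S t f x|) (levy_majorant P X phi a t (fun x => `|f x|)).

(** The bound is uniform in the scaling [c] between [t] and [1]: [c = 1] serves
strong continuity and [c = t] the difference quotients. *)
Lemma semigroup_tail_cvg f r0 m : C0_fun f -> (forall x, r0 <= `|x| -> f x = 0) ->
  0 < m <= 1 ->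
  exists2 r, r0 <= r & exists2 b : R -> \bar R, b t @[t --> 0^'+] --> 0%E &
    forall t c, 0 < t <= 1 -> t <= c <= 1 ->
    (\int[mu]_(x in ~` cball r) (young phi (S t f x / (m * c)))%:E <= b t)%E.
Proof.
move=> Cf f0 /andP[m0 m1].
have Hf : H f by apply: C00_heart => //; split; [case: Cf|exists r0].
have mf := heart_measurable Hf.
have [K K0 fK] := C0_fun_bounded Cf.
pose k := K * expR a / m.
have k0 : 0 <= k by rewrite divr_ge0 ?mulr_ge0 ?expR_ge0// ltW.
have [r r_ge0 tailr] := hXb k0.
exists (r0 + r); first by rewrite lerDl.
have lfin := @lebesgue_cball R d r0.
exists (fun t =>
  (P [set w | (r <= enorm (X t w))%R] * (young phi (k / t))%:E * mu (cball r0))%E).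
  rewrite -[X in _ --> X](mul0e (mu (cball r0))); apply: cvgeMr => //.
  by rewrite ge0_fin_numE.
move=> t c /andP[t0 t1] /andP[tc c1]; have c0 := lt_le_trans t0 tc.
have mc01 : 0 < m * c <= 1 by rewrite mulr_gt0//= mulr_ile1// ltW.
apply: le_trans (modular_semigroup_tail hphi mX hS hST r (ltW t0) mc01 Cf Hf f0) _.
rewrite -muleA; apply: lee_wpmul2l => //.
set q := m * c * expR (- (a * t)).
have q0 : 0 < q by rewrite mulr_gt0 ?expR_gt0// mulr_gt0.
apply: (@le_trans _ _ ((young phi (K / q))%:E * mu (cball r0) + 0)%E).
  apply: modular_split_le => //.
  rewrite integral0_eq// => x /= /negP; rewrite -ltNge => /ltW/f0 ->.
  by rewrite mul0r young0.
rewrite adde0; apply: lee_wpmul2r => //; rewrite lee_fin le_young//.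
have kq : K / q <= k / t.
  rewrite ler_pdivrMr//.
  have -> : k / t * q = K * (expR a * expR (- (a * t)) * (c / t)).
    by rewrite /k /q; field; rewrite !gt_eqF.
  rewrite ler_peMr// mulr_ege1//; last by rewrite ler_pdivlMr// mul1r.
  by rewrite -expRD -[leLHS]expR0 ler_expR subr_ge0 ler_piMr.
have Kq0 : 0 <= K / q by rewrite divr_ge0// ltW.
by rewrite !ger0_norm// (le_trans Kq0 kq).
Qed.

Lemma C00_strongly_continuous f : C00_fun f ->
  lux (S t f \- f) @[t --> 0^'+] --> 0.
Proof.
move=> C00f; have Cf := C00_subC0 C00f; have [cf [r0 f0]] := C00f.
have CSf t : 0 < t -> C0_fun (S t f).
  by move=> t0; apply: (semigroup_stable hS) => //; exact: ltW.
have CD t : 0 < t -> C0_fun (S t f \- f).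
  move=> t0; rewrite (_ : _ \- _ = S t f \+ (fun x => -1 * f x)).
    by apply: C0_funD; [exact: CSf|exact: C0_funZ].
  by apply/funext => x /=; rewrite mulN1r.
apply: luxemburg_small_time.
- by near=> t; apply: C0_fun_measurable; apply: CD; near: t; exact: nbhs_right_gt.
- by near=> t; apply: C0_fun_bounded; apply: CD; near: t; exact: nbhs_right_gt.
- exact: (semigroup_cvg hS).
move=> m m01; have [r r0r [b b0 tb]] := semigroup_tail_cvg Cf f0 m01.
exists r, b => //; near=> t.
have t0 : 0 < t by near: t; exact: nbhs_right_gt.
have t1 : t <= 1 by near: t; exact: nbhs_right_le.
have := tb t 1; rewrite t0 t1 lexx => /(_ isT isT); apply: le_trans.
rewrite le_eqVlt; apply/orP; left; apply/eqP; apply: eq_integral => x.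
rewrite inE/= => /negP; rewrite -ltNge => xr.
by rewrite f0 ?subr0 ?mulr1// (le_trans r0r)// ltW.
Unshelve. all: by end_near. Qed.

Lemma C00_generator_limit f g : C00_fun f -> C00_fun g -> generator_limit S f g ->
  lux (fun x => (S t f x - f x) / t - g x) @[t --> 0^'+] --> 0.
Proof.
move=> C00f C00g [Cg0 fg]; have [Cf Cg] := (C00_subC0 C00f, C00_subC0 C00g).
have [[cf [rf f0]] [cg [rg g0]]] := (C00f, C00g).
pose r0 := Num.max rf rg.
have f0' x : r0 <= `|x| -> f x = 0 by rewrite ge_max => /andP[/f0].
have g0' x : r0 <= `|x| -> g x = 0 by rewrite ge_max => /andP[_ /g0].
have CSf t : 0 < t -> C0_fun (S t f).
  by move=> t0; apply: (semigroup_stable hS) => //; exact: ltW.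
have CD t : 0 < t -> C0_fun (fun x => (S t f x - f x) / t - g x).
  move=> t0; rewrite (_ : (fun x => _) =
      ((fun x => t^-1 * S t f x) \+ (fun x => - t^-1 * f x)) \+ (fun x => -1 * g x)).
    by do 2?apply: C0_funD; apply: C0_funZ => //; exact: CSf.
  by apply/funext => x /=; ring.
apply: luxemburg_small_time => //.
- by near=> t; apply: C0_fun_measurable; apply: CD; near: t; exact: nbhs_right_gt.
- by near=> t; apply: C0_fun_bounded; apply: CD; near: t; exact: nbhs_right_gt.
move=> m m01; have [r r0r [b b0 tb]] := semigroup_tail_cvg Cf f0' m01.
exists r, b => //; near=> t.
have t0 : 0 < t by near: t; exact: nbhs_right_gt.
have t1 : t <= 1 by near: t; exact: nbhs_right_le.
have := tb t t; rewrite t0 t1 lexx => /(_ isT isT); apply: le_trans.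
rewrite le_eqVlt; apply/orP; left; apply/eqP; apply: eq_integral => x.
rewrite inE/= => /negP; rewrite -ltNge => xr.
have xr0 : r0 <= `|x| by rewrite (le_trans r0r)// ltW.
by rewrite f0'// g0'// !subr0 invfM -!mulrA (mulrC t^-1).
Unshelve. all: by end_near. Qed.

End small_time.

(** * Continuous extension of a locally Lipschitz operator *)

Section extension.
Context {R : realType} {d : nat} {phi : R -> R} (hphi : young_generator phi).
Implicit Types (f g h u v : 'rV[R]_d -> R) (rho t m r c e : R).
Local Notation mu := (lebesgue_rV R d).
Local Notation M := (@modular R d phi).
Local Notation H := (@orlicz_heart R d phi).
Local Notation lux := (@luxemburg R d phi).

Lemma ae_equal_luxemburg u v : H u -> H v ->
  (forall e, 0 < e -> lux 1 (u \- v) <= e) -> ae_equal u v.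
Proof.
move=> Hu Hv uv.
have : lux 1 (u \- v) = 0.
  apply/eqP; rewrite eq_le luxemburg_ge0 andbT; apply/ler_addgt0Pr => e e0.
  by rewrite add0r uv.
move=> /(luxemburg_eq0 hphi (heartB hphi Hu Hv)); apply: filterS => x /= /eqP.
by rewrite subr_eq0 => /eqP.
Qed.

Lemma luxemburg_subrr f : lux 1 (f \- f) = 0.
Proof.
rewrite (_ : f \- f = cst 0) ?luxemburg0//.
by apply/funext => x /=; rewrite subrr.
Qed.

Lemma approx_C00 f e : H f -> 0 < e ->
  exists g, [/\ C00_fun g, C0_fun g, H g & lux 1 (g \- f) < e].
Proof.
move=> Hf e0; have e20 : 0 < e / 2 by rewrite divr_gt0.
have [g Cg fg] := C00_dense hphi Hf e20; have Hg := C00_heart hphi Cg.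
exists g; split=> //; first exact: C00_subC0.
by rewrite luxemburgBC// (le_lt_trans fg)// ltr_pdivrMr// ltr_pMr// ltr1n.
Qed.

(** Approximating [(1 - eta) f] instead of [f] keeps the approximation in the
closed ball. *)
Lemma approx_C00_in_ball f rho k e :
  H f -> 1 <= rho -> 0 < k -> lux rho f <= k -> 0 < e ->
  exists g, [/\ C0_fun g, H g, lux 1 (g \- f) < e & lux rho g <= k].
Proof.
move=> Hf rho1 k0 fk e0; pose n := lux 1 f.
have n0 : 0 <= n := luxemburg_ge0 _ _; have n1 : 0 < n + 1 by rewrite ltr_wpDl.
pose eta := Num.min 1 (e / (2 * (n + 1))).
have eta0 : 0 < eta by rewrite lt_min ltr01 divr_gt0// mulr_gt0.
have eta1 : eta <= 1 by rewrite ge_min lexx.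
have eta_n : eta * n <= e / 2.
  apply: (@le_trans _ _ (e / (2 * (n + 1)) * n)).
    by rewrite ler_wpM2r// ge_min lexx orbT.
  rewrite mulrAC ler_pdivrMr ?mulr_gt0//.
  by rewrite (_ : e / 2 * (2 * (n + 1)) = e * (n + 1)) ?ler_pM2l ?lerDl//; field.
have HZ := heartZ hphi (1 - eta) Hf.
have d0 : 0 < Num.min (e / 2) (eta * k) by rewrite lt_min divr_gt0// mulr_gt0.
have [g [_ Cg Hg]] := approx_C00 HZ d0.
rewrite lt_min => /andP[ge gk]; exists g; split=> //.
  apply: (le_lt_trans (luxemburg_triangle hphi _ Hg HZ Hf)) => //.
  rewrite [e]splitr; apply: (ltr_leD ge).
  rewrite (_ : _ \- _ = (fun x => - eta * f x)) ?luxemburgZ ?normrN ?gtr0_norm//.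
  by apply/funext => x /=; ring.
have HB := heartB hphi Hg HZ.
apply: le_trans (luxemburg_le_dist hphi rho1 Hg HZ) _.
rewrite luxemburgZ// ger0_norm ?subr_ge0//.
rewrite (_ : k = eta * k + (1 - eta) * k); last by ring.
apply: lerD; first exact: le_trans (le_luxemburg_rho hphi rho1 HB) (ltW gk).
by rewrite ler_wpM2l// subr_ge0.
Qed.

Section one_operator.
Context {U : ('rV[R]_d -> R) -> 'rV[R]_d -> R}.
Hypothesis U_heart : forall f, C0_fun f -> H f -> H (U f).
Hypothesis U_lip : forall f, H f -> exists L r, [/\ 0 < L, 0 < r &
  forall g h, C0_fun g -> H g -> lux 1 (g \- f) <= r ->
    C0_fun h -> H h -> lux 1 (h \- f) <= r ->
    lux 1 (U g \- U h) <= L * lux 1 (g \- h)].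

(** That the continuous extension of [U] takes the value [u] at [f], where [U] is
looked at on [C_0] only. *)
Definition extension_value f u := H u /\ forall e, 0 < e ->
  exists2 delta, 0 < delta & forall g, C0_fun g -> H g ->
    lux 1 (g \- f) < delta -> lux 1 (U g \- u) <= e.

(** The images of approximants converging fast enough to [f] have summable
increments. *)
Lemma extension_value_exists f : H f -> exists u, extension_value f u.
Proof.
move=> Hf; have [L [r [L0 r0 Ulip]]] := U_lip Hf.
have p0 n : 0 < 2^-1 ^+ n :> R by rewrite exprn_gt0// invr_gt0.
pose q n := Num.min r (2^-1 ^+ n.+2 / L).
have q0 n : 0 < q n by rewrite lt_min r0/= divr_gt0.
have qr n : q n <= r by rewrite ge_min lexx.
have Lq n : L * q n <= 2^-1 ^+ n.+2.
  by rewrite -ler_pdivlMl// mulrC ge_min lexx orbT.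
have [g gP] := choice (fun n => approx_C00 Hf (q0 n)).
have Cg n : C0_fun (g n) by have [] := gP n.
have Hg n : H (g n) by have [] := gP n.
have gf n : lux 1 (g n \- f) <= q n by have [_ _ _ /ltW] := gP n.
have gr n : lux 1 (g n \- f) <= r by exact: le_trans (gf n) (qr n).
have HU n : H (U (g n)) by exact: U_heart.
have Ug h n : C0_fun h -> H h -> lux 1 (h \- f) <= r ->
    lux 1 (U h \- U (g n)) <= L * lux 1 (h \- f) + 2^-1 ^+ n.+2.
  move=> Ch Hh hr; apply: le_trans (Ulip h (g n) Ch Hh hr (Cg n) (Hg n) (gr n)) _.
  apply: le_trans (_ : L * (lux 1 (h \- f) + lux 1 (g n \- f)) <= _).
    rewrite ler_pM2l// (luxemburgBC hphi _ (Hg n) Hf)//.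
    exact: luxemburg_triangle.
  by rewrite mulrDr lerD2l (le_trans _ (Lq n))// ler_pM2l.
have [n|u Hu uU] := heart_complete hphi HU.
  apply: le_trans (Ug (g n.+1) n (Cg _) (Hg _) (gr _)) _.
  apply: le_trans (_ : L * q n.+1 + 2^-1 ^+ n.+2 <= _); first by rewrite lerD2r ler_pM2l.
  by have := Lq n.+1; have := p0 n; rewrite !exprS; lra.
exists u; split=> // e e0; have e40 : 0 < e / 4 by rewrite divr_gt0.
exists (Num.min r (e / 4 / L)) => [|h Ch Hh].
  by rewrite lt_min r0/= divr_gt0.
rewrite lt_min => /andP[/ltW hr hL].
have [N _ /(_ N (leqnn N)) pN] : \forall n \near \oo, `|2^-1 ^+ n| < e / 4 :> R.
  by apply: cvgr0_norm_lt => //; apply: cvg_expr; rewrite ger0_norm; lra.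
rewrite gtr0_norm// in pN.
apply: le_trans (luxemburg_triangle hphi _ (U_heart Ch Hh) (HU N) Hu) _ => //.
have := Ug h N Ch Hh hr; have := uU N; rewrite (luxemburgBC hphi _ Hu (HU N))//.
move: hL; rewrite ltr_pdivlMr// mulrC.
by have := p0 N; rewrite !exprS; move: pN; lra.
Qed.

Definition extend f := xget f [set u | extension_value f u].

Lemma extendP f : H f -> extension_value f (extend f).
Proof. by move=> /extension_value_exists[u fu]; exact: (xgetPex _ (ex_intro _ u fu)). Qed.

Lemma extend_heart f : H f -> H (extend f).
Proof. by move=> /extendP[]. Qed.

Lemma extend_C0 f : C0_fun f -> H f -> ae_equal (extend f) (U f).
Proof.
move=> Cf Hf; have [Hef fe] := extendP Hf; have HUf := U_heart Cf Hf.
apply: ae_equal_luxemburg => // e /fe[delta d0 /(_ f Cf Hf)].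
by rewrite luxemburg_subrr luxemburgBC//; exact.
Qed.

(** Near [f], the extension differs little from [U] on a function that may be
required to lie as close to [f] as desired. *)
Lemma extend_approx f e delta : H f -> 0 < e -> 0 < delta ->
  exists g, [/\ C0_fun g, H g, lux 1 (g \- f) < delta & lux 1 (U g \- extend f) <= e].
Proof.
move=> Hf e0 d0; have [Hef /(_ _ e0)[dl dl0 fe]] := extendP Hf.
have m0 : 0 < Num.min delta dl by rewrite lt_min d0.
have [g [_ Cg Hg]] := approx_C00 Hf m0; rewrite lt_min => /andP[gd gdl].
by exists g; split=> //; exact: fe.
Qed.

(** Both values are close to [U g] for a common [g] near [f]. *)
Lemma extend_unique_at f u : H f -> H u ->
  (forall e, 0 < e -> exists2 delta, 0 < delta & forall g, C0_fun g -> H g ->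
    lux 1 (g \- f) < delta -> lux 1 (U g \- u) <= e) -> ae_equal u (extend f).
Proof.
move=> Hf Hu fu; have Hef := extend_heart Hf.
apply: ae_equal_luxemburg => // e e0; have e20 : 0 < e / 2 by rewrite divr_gt0.
have [delta d0 ud] := fu _ e20.
have [g [Cg Hg gf Ug]] := extend_approx Hf e20 d0.
have HUg := U_heart Cg Hg; have := ud _ Cg Hg gf => gu.
apply: le_trans (luxemburg_triangle hphi _ Hu HUg Hef) _ => //.
by rewrite (luxemburgBC hphi _ Hu HUg)// [e]splitr; exact: (lerD gu Ug).
Qed.

Lemma extend_compat f g : H f -> H g -> ae_equal f g -> ae_equal (extend f) (extend g).
Proof.
move=> Hf Hg fg; apply: extend_unique_at => //; first exact: extend_heart.
move=> e e0; have [Hef /(_ _ e0)[delta d0 fe]] := extendP Hf.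
exists delta => // h Ch Hh hg; apply: fe => //.
rewrite (luxemburg_ae_eq hphi _ (heartB hphi Hh Hf) (heartB hphi Hh Hg))//.
by apply: filterS fg => x /= ->.
Qed.

Lemma extend_unique V : continuous_extension phi U V ->
  forall f, H f -> ae_equal (V f) (extend f).
Proof.
move=> [V_heart V_compat V_cont V_eq] f Hf.
apply: extend_unique_at => //; first exact: V_heart.
move=> e e0; have [delta d0 Vd] := V_cont _ Hf _ e0; exists delta => // g Cg Hg gf.
have [HVf HVg HUg] : [/\ H (V f), H (V g) & H (U g)].
  by split; [exact: V_heart|exact: V_heart|exact: U_heart].
rewrite -(luxemburg_ae_eq hphi _ (heartB hphi HVg HVf) (heartB hphi HUg HVf))//.
  by apply: ltW; exact: Vd.
by apply: filterS (V_eq g Cg Hg) => x /= ->.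
Qed.

(** The estimate is applied to approximants that lie in the same ball as [f]. *)
Lemma extend_luxemburg_le rho k K f : 1 <= rho -> 0 < k -> 0 <= K ->
  (forall g, C0_fun g -> H g -> lux rho g <= k -> lux rho (U g) <= K * lux rho g) ->
  H f -> lux rho f <= k -> lux rho (extend f) <= K * lux rho f.
Proof.
move=> rho1 k0 K0 UK Hf fk; have [Hef fe] := extendP Hf.
apply/ler_addgt0Pr => e e0; have e20 : 0 < e / 2 by rewrite divr_gt0.
have [delta d0 {}fe] := fe _ e20.
have K1 : 0 < K + 1 by rewrite ltr_wpDl.
have d0' : 0 < Num.min delta (e / 2 / (K + 1)) by rewrite lt_min d0/= divr_gt0.
have [g [Cg Hg + gk]] := approx_C00_in_ball Hf rho1 k0 fk d0'.
rewrite lt_min => /andP[gd ge].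
have HUg := U_heart Cg Hg; have HB := heartB hphi Hef HUg; have HB' := heartB hphi Hg Hf.
have efU : lux rho (extend f \- U g) <= e / 2.
  rewrite (le_trans (le_luxemburg_rho hphi rho1 HB))// luxemburgBC//.
  exact: fe.
have Kgf : K * lux rho (g \- f) <= e / 2.
  apply: (@le_trans _ _ (K * (e / 2 / (K + 1)))).
    by rewrite ler_wpM2l// (le_trans (le_luxemburg_rho hphi rho1 HB'))// ltW.
  by rewrite mulrA ler_pdivrMr// mulrC ler_pM2l// lerDl.
have KUg : lux rho (U g) <= e / 2 + K * lux rho f.
  apply: le_trans (UK _ Cg Hg gk) _.
  apply: le_trans (_ : K * (lux rho (g \- f) + lux rho f) <= _).
    by rewrite ler_wpM2l// luxemburg_le_dist.
  by rewrite mulrDr lerD2r.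
apply: le_trans (luxemburg_le_dist hphi rho1 Hef HUg) _.
apply: le_trans (lerD efU KUg) _.
by rewrite addrA -splitr addrC.
Qed.

(** The excess of the left-hand side over the right-hand side is bounded by the
distances to the corresponding values on approximants. *)
Lemma extend_convex s f g : 0 <= s <= 1 -> H f -> H g ->
  (forall u v, C0_fun u -> H u -> C0_fun v -> H v ->
    ae_le (U (fun x => s * u x + (1 - s) * v x))
          (fun x => s * U u x + (1 - s) * U v x)) ->
  ae_le (extend (fun x => s * f x + (1 - s) * g x))
        (fun x => s * extend f x + (1 - s) * extend g x).
Proof.
move=> /andP[s0 s1] Hf Hg Ucvx.
have excess (A B C D F G : R) : D <= s * F + (1 - s) * G ->
    A - (s * B + (1 - s) * C) <= A - D + (s * (F - B) + (1 - s) * (G - C)) by lra.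
set h := (fun x => s * f x + _).
have comb u v : H u -> H v -> H (fun x => s * u x + (1 - s) * v x).
  by move=> Hu Hv; apply: heartD => //; exact: heartZ.
have Hh : H h by exact: comb.
have [[[Hef _] [Heg _]] [Heh he]] := (extendP Hf, extendP Hg, extendP Hh).
have Hc := comb _ _ Hef Heg.
pose W := (extend h \- (fun x => s * extend f x + (1 - s) * extend g x)) \max cst 0.
have HD := heartB hphi Heh Hc.
have HW : H W.
  apply: (heart_le hphi HD).
    by apply: measurable_maxr => //; exact: heart_measurable HD.
  by apply: aeW => x; rewrite /W /= /Num.max; case: ifP; rewrite ?normr0.
suff /(ae_equal_luxemburg HW heart0) : forall e, 0 < e -> lux 1 (W \- cst 0) <= e.
  apply: filterS => x; rewrite /W /= => /max_idPr.
  by rewrite subr_le0.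
move=> e e0; rewrite (_ : W \- cst 0 = W); last by apply/funext => x /=; rewrite subr0.
have e30 : 0 < e / 3 by rewrite divr_gt0.
have [delta d0 {}he] := he _ e30; have d20 : 0 < delta / 2 by rewrite divr_gt0.
have [u [Cu Hu uf Uu]] := extend_approx Hf e30 d20.
have [v [Cv Hv vg Uv]] := extend_approx Hg e30 d20.
pose w := fun x => s * u x + (1 - s) * v x.
have Hw : H w by exact: comb.
have Cw : C0_fun w by apply: C0_funD; exact: C0_funZ.
have s1' : 0 <= 1 - s by rewrite subr_ge0.
have [HUu HUv HUw] : [/\ H (U u), H (U v) & H (U w)] by split; exact: U_heart.
have [HBu HBv] := (heartB hphi HUu Hef, heartB hphi HUv Heg).
have lcomb y z : H y -> H z ->
    lux 1 (fun x => s * y x + (1 - s) * z x) <= s * lux 1 y + (1 - s) * lux 1 z.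
  move=> Hy Hz; have -> : s * lux 1 y + (1 - s) * lux 1 z =
      lux 1 (fun x => s * y x) + lux 1 (fun x => (1 - s) * z x).
    by rewrite !luxemburgZ// !ger0_norm.
  apply: luxemburg_le_add => //; [exact: heartZ|exact: heartZ| |].
    exact: heart_measurable (comb _ _ Hy Hz).
  by apply: aeW => x; exact: ler_normD.
have wavg (p q : R) : 0 <= p -> 0 <= q -> s * p + (1 - s) * q <= p + q.
  by move=> p0 q0; rewrite lerD// ler_piMl// gerBl.
have wh : lux 1 (U w \- extend h) <= e / 3.
  apply: he => //; rewrite (_ : w \- h = fun x => s * (u \- f) x + (1 - s) * (v \- g) x).
    have [HBuf HBvg] := (heartB hphi Hu Hf, heartB hphi Hv Hg).
    apply: le_lt_trans (lcomb _ _ HBuf HBvg) _.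
    apply: le_lt_trans (wavg _ _ (luxemburg_ge0 _ _) (luxemburg_ge0 _ _)) _.
    by rewrite [delta]splitr ltrD.
  by apply/funext => x; rewrite /w /h /=; ring.
have HBw := heartB hphi Heh HUw.
have Hcc := comb _ _ HBu HBv.
apply: (@le_trans _ _ (lux 1 (extend h \- U w) +
    lux 1 (fun x => s * (U u \- extend f) x + (1 - s) * (U v \- extend g) x))).
  apply: luxemburg_le_add => //; first exact: heart_measurable HW.
  apply: filterS (Ucvx _ _ Cu Hu Cv Hv) => x wx.
  rewrite /W /= [leLHS]ger0_norm ?le_max ?lexx ?orbT//.
  rewrite ge_max addr_ge0// andbT -/w in wx *.
  apply: le_trans (lerD (ler_norm _) (ler_norm _)) => //=.
  exact: excess.
rewrite (luxemburgBC hphi _ Heh HUw)// (_ : e = e / 3 + (e / 3 + e / 3)); last by field.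
apply: (lerD wh); apply: le_trans (lcomb _ _ HBu HBv) _.
apply: le_trans (wavg _ _ (luxemburg_ge0 _ _) (luxemburg_ge0 _ _)) _.
exact: (lerD Uu Uv).
Qed.

End one_operator.
End extension.

(** * The extended semigroup *)

Section extended_semigroup.
Context {R : realType} {d : nat} {phi : R -> R} (hphi : young_generator phi).
Context {disp : measure_display} {Omega : measurableType disp}
  {P : probability Omega R} {X : R -> Omega -> 'rV[R]_d} {a : R}
  {S : R -> ('rV[R]_d -> R) -> ('rV[R]_d -> R)}.
Hypothesis a0 : 0 <= a.
Hypothesis mX : forall t : R, 0 <= t -> measurable_fun setT (X t).
Hypothesis hXb : small_time_tails P X phi.
Hypothesis hS : C0_semigroup S.
Hypothesis hST : forall (t : R) f, 0 <= t -> (C0_fun `&` orlicz_heart phi) f ->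
  ae_le (fun x => `|S t f x|) (levy_majorant P X phi a t (fun x => `|f x|)).
Implicit Types (f g h u v : 'rV[R]_d -> R) (rho t m r c : R).
Local Notation H := (@orlicz_heart R d phi).
Local Notation lux := (@luxemburg R d phi).

Let S_stable t f : 0 <= t -> C0_fun f -> H f -> H (S t f).
Proof. exact: (heart_semigroup hphi mX hS hST). Qed.

Let S_heart t : 0 <= t -> forall f, C0_fun f -> H f -> H (S t f).
Proof. by move=> t0 f; exact: S_stable. Qed.

Let S_convex t s f g : 0 <= t -> C0_fun f -> H f -> C0_fun g -> H g -> 0 <= s <= 1 ->
  ae_le (S t (fun x => s * f x + (1 - s) * g x))
        (fun x => s * S t f x + (1 - s) * S t g x).
Proof.
by move=> t0 Cf _ Cg _ s01; apply: aeW; exact: (semigroup_convex hS t0 Cf Cg s01).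
Qed.

Let C0_comb c e f g : C0_fun f -> C0_fun g -> C0_fun (fun x => c * f x + e * g x).
Proof. by move=> Cf Cg; apply: C0_funD; exact: C0_funZ. Qed.

Let S_norm : norm_estimate phi a C0_fun S := C0_norm_estimate hphi mX hS hST.

Lemma C0_lipschitz_estimate : lipschitz_estimate phi a C0_fun S.
Proof. exact: (convex_lipschitz_estimate hphi C0_comb S_stable S_convex S_norm). Qed.

Lemma C0_local_lipschitz_estimate : local_lipschitz_estimate phi a C0_fun S.
Proof.
exact: (convex_local_lipschitz_estimate hphi a0 C0_comb S_stable S_convex S_norm).
Qed.

Let S_lip t : 0 <= t -> forall f, H f -> exists L r, [/\ 0 < L, 0 < r &
  forall g h, C0_fun g -> H g -> lux 1 (g \- f) <= r ->
    C0_fun h -> H h -> lux 1 (h \- f) <= r ->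
    lux 1 (S t g \- S t h) <= L * lux 1 (g \- h)].
Proof.
move=> t0 f Hf; have [rho [r [rho1 r0 Sl]]] := C0_local_lipschitz_estimate Hf t0.
have rho0 : 0 < rho by exact: lt_le_trans rho1.
exists (4 * rho * expR (a * t)), r; split=> //.
  by rewrite !mulr_gt0// expR_gt0.
move=> g h Cg Hg gr Ch Hh hr; apply: (Sl t g h) => //; first by rewrite t0 lexx.
Qed.

Definition extended_semigroup (t : R) : ('rV[R]_d -> R) -> 'rV[R]_d -> R :=
  extend (phi := phi) (U := S t).

Local Notation St := extended_semigroup.

Lemma extended_semigroupP t f : 0 <= t -> H f ->
  extension_value (phi := phi) (U := S t) f (St t f).
Proof. by move=> t0; exact: (extendP hphi (S_heart t0) (S_lip t0)). Qed.

Lemma extended_semigroup_heart t f : 0 <= t -> H f -> H (St t f).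
Proof. by move=> t0 /(extended_semigroupP t0)[]. Qed.

Lemma extended_semigroup_C0 t f : 0 <= t -> C0_fun f -> H f -> ae_equal (St t f) (S t f).
Proof. by move=> t0; exact: (extend_C0 hphi (S_heart t0) (S_lip t0)). Qed.

Lemma extended_norm_estimate : norm_estimate phi a setT St.
Proof.
move=> t rho f t0 rho1 [_ /orlicz_ball0[Hf fk]].
apply: (extend_luxemburg_le hphi (S_heart t0) (S_lip t0) rho1 (expR_gt0 _)
  (expR_ge0 _) _ Hf fk).
move=> g Cg Hg gk; apply: S_norm => //; split=> //; exact/orlicz_ball0.
Qed.

Let St_heart t f : 0 <= t -> setT f -> H f -> H (St t f).
Proof. by move=> t0 _; exact: extended_semigroup_heart. Qed.

Let St_convex t s f g : 0 <= t -> setT f -> H f -> setT g -> H g -> 0 <= s <= 1 ->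
  ae_le (St t (fun x => s * f x + (1 - s) * g x))
        (fun x => s * St t f x + (1 - s) * St t g x).
Proof.
move=> t0 _ Hf _ Hg s01.
apply: (extend_convex hphi (S_heart t0) (S_lip t0) s01 Hf Hg) => u v Cu Hu Cv Hv.
exact: S_convex.
Qed.

Let setT_comb c e f g : setT f -> setT g -> setT (fun x => c * f x + e * g x).
Proof. by []. Qed.

Lemma extended_lipschitz_estimate : lipschitz_estimate phi a setT St.
Proof.
exact: (convex_lipschitz_estimate hphi setT_comb St_heart St_convex
  extended_norm_estimate).
Qed.

Lemma extended_local_lipschitz_estimate : local_lipschitz_estimate phi a setT St.
Proof.
exact: (convex_local_lipschitz_estimate hphi a0 setT_comb St_heart St_convex
  extended_norm_estimate).
Qed.

Lemma extended_semigroup_continuous t : 0 <= t -> orlicz_continuous phi (St t).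
Proof.
move=> t0 f Hf e e0.
have [rho [r [rho1 r0 Sl]]] := extended_local_lipschitz_estimate Hf t0.
have L0 : 0 < 4 * rho * expR (a * t).
  by rewrite !mulr_gt0 ?expR_gt0//; exact: lt_le_trans rho1.
exists (Num.min r (e / (4 * rho * expR (a * t)))); first by rewrite lt_min r0 divr_gt0.
move=> g Hg; rewrite lt_min => /andP[/ltW gr].
rewrite ltr_pdivlMr// mulrC; apply: le_lt_trans.
apply: (Sl t g f); first by rewrite t0 lexx.
  by split.
by split=> //; split=> //; rewrite luxemburg_subrr// ltW.
Qed.

Lemma extended_semigroup_extension t : 0 <= t -> continuous_extension phi (S t) (St t).
Proof.
move=> t0; split.
- by move=> f; exact: extended_semigroup_heart.
- exact: (extend_compat hphi (S_heart t0) (S_lip t0)).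
- exact: extended_semigroup_continuous.
- by move=> f; exact: extended_semigroup_C0.
Qed.

Lemma extended_semigroup_unique t U : 0 <= t -> continuous_extension phi (S t) U ->
  forall f, H f -> ae_equal (U f) (St t f).
Proof. by move=> t0; exact: (extend_unique hphi (S_heart t0) (S_lip t0)). Qed.

Lemma extended_semigroup_id f : H f -> ae_equal (St 0 f) f.
Proof.
move=> Hf; have t0 : 0 <= 0 :> R by [].
suff : ae_equal f (St 0 f) by apply: filterS => x ->.
apply: (extend_unique_at hphi (S_heart t0) (S_lip t0) Hf Hf) => e e0.
by exists e => // g Cg Hg /ltW; rewrite (semigroup_id hS Cg).
Qed.

Lemma extended_semigroup_comp s t f : 0 <= s -> 0 <= t -> H f ->
  ae_equal (St (s + t) f) (St s (St t f)).
Proof.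
move=> s0 t0 Hf; have st0 : 0 <= s + t by rewrite addr_ge0.
have [Htf tf] := extended_semigroupP t0 Hf.
have [Hsf sf] := extended_semigroupP s0 Htf.
suff : ae_equal (St s (St t f)) (St (s + t) f) by apply: filterS => x ->.
apply: (extend_unique_at hphi (S_heart st0) (S_lip st0) Hf Hsf) => e e0.
have [d1 d10 sfe] := sf _ e0; have d120 : 0 < d1 / 2 by rewrite divr_gt0.
have [d2 d20 tfe] := tf _ d120; exists d2 => // g Cg Hg gf.
rewrite (semigroup_comp hS s0 t0 Cg); apply: sfe.
- exact: (semigroup_stable hS).
- exact: S_heart.
- by apply: (le_lt_trans (tfe g Cg Hg gf)); rewrite ltr_pdivrMr// ltr_pMr// ltr1n.
Qed.

(** On a dense set [S t g] converges to [g], and the Lipschitz constants near [f]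
are bounded uniformly in [t <= 1]. *)
Lemma extended_semigroup_cvg f : H f -> lux 1 (St t f \- f) @[t --> 0^'+] --> 0.
Proof.
move=> Hf; apply/cvgr0Pnorm_le => e e0.
have [rho [r [rho1 r0 Sl]]] := extended_local_lipschitz_estimate Hf ler01.
have rho0 : 0 < rho by exact: lt_le_trans rho1.
pose L := 4 * rho * expR a.
have L0 : 0 < L by rewrite !mulr_gt0 ?expR_gt0.
have e30 : 0 < e / 3 by rewrite divr_gt0.
have d0 : 0 < Num.min r (Num.min (e / 3) (e / 3 / L)) by rewrite !lt_min r0 e30 divr_gt0.
have [g [C00g Cg Hg]] := approx_C00 hphi Hf d0.
rewrite !lt_min => /and3P[/ltW gr /ltW ge gL].
have /cvgr0Pnorm_le/(_ _ e30) Sg := C00_strongly_continuous hphi a0 mX hXb hS hST C00g.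
near=> t.
have t0 : 0 <= t by apply: ltW; near: t; exact: nbhs_right_gt.
have t1 : t <= 1 by near: t; exact: nbhs_right_le.
have [HSf HSg HSSg] : [/\ H (St t f), H (St t g) & H (S t g)].
  by split; [exact: extended_semigroup_heart..|exact: S_heart].
have Sfg : lux 1 (St t f \- St t g) <= e / 3.
  apply: (@le_trans _ _ (4 * rho * expR (a * t) * lux 1 (f \- g))).
    apply: (Sl t f g); first by rewrite t0.
      by split=> //; split=> //; rewrite luxemburg_subrr// ltW.
    by split.
  rewrite (luxemburgBC hphi _ Hf Hg)//; move: gL; rewrite ltr_pdivlMr// mulrC => /ltW.
  apply: le_trans; rewrite ler_wpM2r ?luxemburg_ge0// /L ler_wpM2l//; last first.
    by rewrite ler_expR ler_piMr.
  by rewrite mulr_ge0// ltW.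
have Sgg : lux 1 (St t g \- g) <= e / 3.
  rewrite (luxemburg_ae_eq hphi _ (heartB hphi HSg Hg) (heartB hphi HSSg Hg))//.
    by apply: le_trans (ler_norm _) _; near: t.
  by have := extended_semigroup_C0 t0 Cg Hg; apply: filterS => x /= ->.
rewrite ger0_norm ?luxemburg_ge0// (_ : e = e / 3 + (e / 3 + e / 3)); last by field.
apply: le_trans (luxemburg_triangle hphi _ HSf HSg Hf) _ => //; apply: (lerD Sfg).
apply: le_trans (luxemburg_triangle hphi _ HSg Hg Hf) _ => //.
exact: (lerD Sgg ge).
Unshelve. all: by end_near. Qed.

Lemma extended_orlicz_semigroup : orlicz_semigroup phi St.
Proof.
split.
- by move=> t f; exact: extended_semigroup_heart.
- by move=> t f g t0; exact: (extension_compat (extended_semigroup_extension t0)).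
- exact: extended_semigroup_id.
- by move=> s t f; exact: extended_semigroup_comp.
- exact: extended_semigroup_cvg.
- by move=> t s f g t0 Hf Hg s01; exact: St_convex.
Qed.

End extended_semigroup.

Theorem theorem3p7 (R : realType) (d : nat) (phi : R -> R) (a : R)
    (disp : measure_display) (Omega : measurableType disp)
    (P : probability Omega R) (X : R -> Omega -> 'rV[R]_d)
    (S : R -> ('rV[R]_d -> R) -> ('rV[R]_d -> R))
    (hphi : young_generator phi) (ha : 0 <= a)
    (hX : levy_process P X)
    (hXa : bounded_densities P X) (hXb : small_time_tails P X phi)
    (hS : C0_semigroup S)
    (hST : forall (t : R) f, 0 <= t -> (C0_fun `&` orlicz_heart phi) f ->
      ae_le (fun x => `|S t f x|)
            (levy_majorant P X phi a t (fun x => `|f x|))) :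
  [/\ (forall (t : R) f, 0 <= t -> (C0_fun `&` orlicz_heart phi) f ->
         (C0_fun `&` orlicz_heart phi) (S t f)),
      norm_estimate phi a C0_fun S,
      lipschitz_estimate phi a C0_fun S &
      local_lipschitz_estimate phi a C0_fun S] /\
  (exists St : R -> ('rV[R]_d -> R) -> ('rV[R]_d -> R),
    (forall t : R, 0 <= t ->
      continuous_extension phi (S t) (St t) /\
      forall U, continuous_extension phi (S t) U ->
        forall f, orlicz_heart phi f -> ae_equal (U f) (St t f)) /\
    [/\ norm_estimate phi a setT St,
        lipschitz_estimate phi a setT St,
        local_lipschitz_estimate phi a setT St &
        orlicz_semigroup phi St]) /\
  (forall f, (generator_domain S `&` Cc_fun) f -> Cc_fun (generator S f) ->
    luxemburg phi 1 (fun x => (S t f x - f x) / t - generator S f x)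
      @[t --> 0^'+] --> 0).
Proof.
have mX := levy_measurable hX.
split; [split|split].
- move=> t f t0 [Cf Hf]; split; first exact: (semigroup_stable hS).
  exact: (heart_semigroup hphi mX hS hST).
- exact: (C0_norm_estimate hphi mX hS hST).
- exact: (C0_lipschitz_estimate hphi mX hS hST).
- exact: (C0_local_lipschitz_estimate hphi ha mX hS hST).
- exists (extended_semigroup (phi := phi) (S := S)); split.
    move=> t t0; split; first exact: (extended_semigroup_extension hphi ha mX hS hST).
    by move=> U; exact: (extended_semigroup_unique hphi ha mX hS hST).
  split.
  + exact: (extended_norm_estimate hphi ha mX hS hST).
  + exact: (extended_lipschitz_estimate hphi ha mX hS hST).
  + exact: (extended_local_lipschitz_estimate hphi ha mX hS hST).
  + exact: (extended_orlicz_semigroup hphi ha mX hXb hS hST).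
move=> f [[_ [g fg]] Cf] Cg.
apply: (C00_generator_limit hphi ha mX hXb hS hST (Cc_subC00 Cf) (Cc_subC00 Cg)).
by rewrite /generator; apply: getPex; exists g.
Qed.
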